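(* Let $G$ be a countably infinite amenable group and let $G\curvearrowright X$ be a free continuous action on a compact metrizable space $X$. Then the following are equivalent: (i) the action is almost finite; (ii) the action has the small boundary property and comparison; (iii) the action has the small boundary property and $m$-comparison for some integer $m\geq 0$.
   Context: Fix a compatible metric on $X$. $M_G(X)$ denotes the set of $G$-invariant Borel probability measures on $X$. Small boundary property: there is a basis for the topology of $X$ consisting of open sets $U$ with $\mu(\partial U)=0$ for every $\mu\in M_G(X)$. Subequivalence: for $m\geq 0$ and $A,B\subseteq X$ write $A\prec_m B$ if for every closed set $C\subseteq A$ there are a finite collection $\mathcal{U}$ of open subsets of $X$ covering $C$, an element $s_U\in G$ for each $U\in\mathcal{U}$, and a partition $\mathcal{U}=\mathcal{U}_0\sqcup\cdots\sqcup\mathcal{U}_m$ such that for each $i=0,\dots,m$ the sets $s_U U$ for $U\in\mathcal{U}_i$ are pairwise disjoint and contained in $B$. Write $A\prec B$ for $A\prec_0 B$. The action has $m$-comparison if $A\prec_m B$ for all nonempty open sets $A,B\subseteq X$ satisfying $\mu(A)<\mu(B)$ for every $\mu\in M_G(X)$; comparison means $0$-comparison. Towers and castles: a finite set $F\subseteq G$ is $(K,\delta)$-invariant (for $K\subseteq G$ finite and $\delta>0$) if $|KF\,\Delta\, F|<\delta|F|$. A tower is a pair $(V,S)$ with $V\subseteq X$ and $S\subseteq G$ finite such that the sets $sV$, $s\in S$ (its levels), are pairwise disjoint; $S$ is its shape. It is open if $V$ is open. A castle is a finite collection of towers $\{(V_i,S_i)\}_{i\in I}$ such that the sets $S_iV_i$,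 $i\in I$, are pairwise disjoint; it is open if each of its towers is open. Almost finiteness: the free action is almost finite if for every $n\in\mathbb{N}$ ($n\ge 1$), finite set $K\subseteq G$, and $\delta>0$ there are (1) an open castle $\{(V_i,S_i)\}_{i\in I}$ whose shapes are $(K,\delta)$-invariant and whose levels have diameter less than $\delta$, and (2) sets $S_i'\subseteq S_i$ with $|S_i'|<|S_i|/n$ such that $X\setminus\bigsqcup_{i\in I}S_iV_i\prec\bigsqcup_{i\in I}S_i'V_i$.
   Formalization: In the definition of almost finiteness the finite set K is required to be nonempty: for K empty and δ ≤ 1 no finite set is (K,δ)-invariant, so no action on a nonempty space would be almost finite and the equivalence would fail. *)

(* Defs.v *)
From HB Require Import structures.
From mathcomp Require Import all_boot all_order all_algebra finmap.
From mathcomp Require Import all_classical all_reals all_analysis.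

Set Implicit Arguments.
Unset Strict Implicit.
Unset Printing Implicit Defensive.

Import Order.TTheory GRing.Theory Num.Theory.

Local Open Scope classical_set_scope.
Local Open Scope ring_scope.

(* Amenability of a discrete group, by an invariant mean: a left-invariant
   finitely additive probability measure on all subsets of [G]. *)
Definition amenable (R : realType) (G : groupType) : Prop :=
  exists m : set G -> R,
    [/\ forall A, 0 <= m A,
        m [set: G] = 1,
        forall A B, A `&` B = set0 -> m (A `|` B) = m A + m B
      & forall g A, m ((fun h => (g * h)%g) @` A) = m A].

(* [G] is discrete, so that joint continuity is continuity of every [act g]. *)
Record continuous_action (G : groupType) (X : topologicalType) := {
  act :> G -> X -> X ;
  act1 : forall x, act 1%g x = x ;
  actM : forall g h x, act (g * h)%g x = act g (act h x) ;
  act_continuous : forall g, continuous (act g)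
}.

Definition free_action (G : groupType) (X : topologicalType)
    (a : continuous_action G X) : Prop :=
  forall g x, a g x = x -> g = 1%g.

Definition boundary (X : topologicalType) (A : set X) : set X :=
  closure A `\` A°.

(* A [measurableType] carries a distinguished point, which a topological space
   does not.  The Borel space of [X] is therefore built from a point [x0], on
   which neither its measurable sets nor its measures depend. *)
Definition pointed_at (X : topologicalType) (x0 : X) : Type := X.

HB.instance Definition _ (X : topologicalType) (x0 : X) :=
  Choice.on (pointed_at x0).
HB.instance Definition _ (X : topologicalType) (x0 : X) :=
  isPointed.Build (pointed_at x0) (x0 : pointed_at x0).

Notation borelType x0 :=
  (@g_sigma_algebraType (pointed_at x0) (@open _)).

(* The measures in M_G(X), seen as set functions; only their values on Borel
   sets are meaningful.  There are none when [X] is empty. *)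
Definition invariant_measures (R : realType) (G : groupType)
    (X : topologicalType) (a : continuous_action G X) :
    set (set X -> \bar R) :=
  [set mu : set X -> \bar R |
    exists (x0 : X) (P : probability (borelType x0) R),
    mu = (P : set X -> \bar R) /\
    forall g (A : set (borelType x0)), measurable A -> P (a g @` A) = P A].

Definition small_boundary_property (R : realType) (G : groupType)
    (X : topologicalType) (a : continuous_action G X) : Prop :=
  exists2 B : set (set X), basis B &
    forall U, B U ->
      forall mu : set X -> \bar R,
        invariant_measures a mu -> mu (boundary U) = 0%E.

(* The partition of [UU] into m + 1 possibly empty parts is given by the
   function [c] sending a member of [UU] to the index of its part. *)
Definition subequivalent (G : groupType) (X : topologicalType)
    (a : continuous_action G X) (m : nat) (A B : set X) : Prop :=
  forall C : set X, closed C -> C `<=` A ->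
    exists (UU : set (set X)) (s : set X -> G) (c : set X -> 'I_m.+1),
      [/\ finite_set UU,
          UU `<=` open,
          C `<=` \bigcup_(U in UU) U
        & forall i : 'I_m.+1,
            trivIset (UU `&` c @^-1` [set i]) (fun U => a (s U) @` U) /\
            forall U, (UU `&` c @^-1` [set i]) U -> a (s U) @` U `<=` B].

Definition has_comparison (R : realType) (G : groupType)
    (X : topologicalType) (a : continuous_action G X) (m : nat) : Prop :=
  forall A B : set X, open A -> open B -> A !=set0 -> B !=set0 ->
    (forall mu : set X -> \bar R,
       invariant_measures a mu -> (mu A < mu B)%E) ->
    subequivalent a m A B.

Definition invariant_shape (R : realType) (G : groupType) (K : {fset G})
    (delta : R) (F : {fset G}) : Prop :=
  let KF := [fset (k * f)%g | k in K, f in F]%fset in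
  #|` ((KF `\` F) `|` (F `\` KF))%fset|%:R < delta * #|` F|%:R.

Definition is_tower (G : groupType) (X : topologicalType)
    (a : continuous_action G X) (V : set X) (S : {fset G}) : Prop :=
  trivIset [set` S] (fun s => a s @` V).

Definition tower_support (G : groupType) (X : topologicalType)
    (a : continuous_action G X) (V : set X) (S : {fset G}) : set X :=
  \bigcup_(s in [set` S]) (a s @` V).

Definition is_castle (G : groupType) (X : topologicalType)
    (a : continuous_action G X) (I : finType)
    (V : I -> set X) (S : I -> {fset G}) : Prop :=
  (forall i, is_tower a (V i) (S i)) /\
  trivIset [set: I] (fun i => tower_support a (V i) (S i)).

Definition is_open_castle (G : groupType) (X : topologicalType)
    (a : continuous_action G X) (I : finType)
    (V : I -> set X) (S : I -> {fset G}) : Prop :=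
  is_castle a V S /\ forall i, open (V i).

(* With this convention, the empty set has diameter -oo. *)
Definition diameter (R : realType) (X : metricType R) (A : set X) : \bar R :=
  ereal_sup [set (mdist x y)%:E | x in A & y in A].

(* [K] is nonempty, as is implicit in the use of (K, delta)-invariance: for
   delta <= 1 no set at all is (set0, delta)-invariant, so that no action on a
   nonempty space would be almost finite. *)
Definition almost_finite (R : realType) (G : groupType) (X : metricType R)
    (a : continuous_action G X) : Prop :=
  forall (n : nat) (K : {fset G}) (delta : R),
    (1 <= n)%N -> K != fset0 -> 0 < delta ->
    exists (I : finType) (V : I -> set X) (S S' : I -> {fset G}),
      [/\ is_open_castle a V S,
          forall i, invariant_shape K delta (S i),
          forall i s, s \in S i -> (diameter (a s @` V i) < delta%:E)%E,
          forall i, (S' i `<=` S i)%fset /\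
                    #|` S' i|%:R < #|` S i|%:R / n%:R :> R
        & subequivalent a 0
            (~` \bigcup_i tower_support a (V i) (S i))
            (\bigcup_i tower_support a (V i) (S' i))].

(* Main.v *)
From HB Require Import structures.
Require Import Defs.
From mathcomp Require Import all_boot all_order all_algebra finmap.
From mathcomp Require Import all_classical all_reals all_analysis.
From mathcomp Require Import zify ring lra.

Set Implicit Arguments.
Unset Strict Implicit.
Unset Printing Implicit Defensive.

Import Order.TTheory GRing.Theory Num.Theory.
Import numFieldNormedType.Exports measurable_realfun.

Local Open Scope classical_set_scope.
Local Open Scope ring_scope.

(** Both equivalences follow from three facts: almost finiteness implies
    comparison ([almost_finite_comparison]) and the small boundary property
    ([almost_finite_small_boundary]), and the small boundary property together
    with [m]-comparison implies almost finiteness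
    ([comparison_almost_finite]).

    Invariant measures and orbits are linked by [uniform_gap]: if a closed set
    [A] has smaller mass than an open set [B] for every invariant measure, then
    every sufficiently invariant finite set [F] and every point [x] see it, that
    is, a smaller proportion of [F x] lies near [A] than deep inside [B].
    Otherwise the empirical measures of a net of counterexamples would converge
    along an ultrafilter to an invariant finitely additive probability, and its
    regularization ([content_probability]) would be an invariant measure that
    contradicts the hypothesis.

    Comparison: when [C] is a closed subset of [A], the gap says that in every
    tower of a castle with invariant shapes and small levels the levels that
    meet [C] are outnumbered by those contained in [B].  The former are moved
    onto part of the latter, and the remainder of the castle, which is
    subequivalent to few levels, onto the rest.

    Small boundaries: the boundary of a union of levels lies in the remainder,
    and the remainder has a neighbourhood of small mass.  Hence between a closed
    set and an open set containing it there are sets with a boundary of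
    uniformly small mass; increasing unions of such sets, with neighbourhoods of
    their boundaries chosen so as to decrease, have null boundaries.

    Almost finiteness: sets with null boundary form an invariant algebra, which
    replaces the clopen sets of the zero-dimensional case.  Freeness and the
    small boundary property cover [X] by bases of small towers from this algebra
    for any given shape, and an Ornstein--Weiss quasi-tiling with finitely many
    shapes, each almost invariant under the inverses of the smaller ones, covers
    all but a small proportion of [X] for every invariant measure
    ([tiling_mass]).  It is cut into a castle, of which the bases are replaced by
    their interiors ([almost_finite_in_measure]).  The remainder is closed and
    has small mass, hence so has a neighbourhood of it
    ([closed_neighbourhood]).  By [m]-comparison this neighbourhood goes into a
    small proportion of the levels with [m + 1] colours, and reserving [m + 1]
    disjoint copies of that proportion makes all the pieces disjoint.

    The shapes come from Folner sets, which are obtained from the invariant mean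
    through Hall's theorem ([amenable_folner]). *)

(** * Hall's theorem for families of finite sets *)

Section Hall.
Context {I T : choiceType}.
Implicit Types (A B : I -> {fset T}) (J : {fset I}).

(** Hall's condition, for possibly infinite families of finite sets. *)
Definition hall A := forall J, (#|` J| <= #|` \bigcup_(i <- J) A i|%fset)%N.

Lemma fcupsS A B J : (forall i, i \in J -> A i `<=` B i)%fset ->
  (\bigcup_(i <- J) A i `<=` \bigcup_(i <- J) B i)%fset.
Proof.
move=> AB; apply/fsubsetP => x /bigfcupP[i /andP[iJ _] xA].
by apply/bigfcupP; exists i; rewrite ?iJ//; exact: (fsubsetP (AB i iJ)).
Qed.

(** The pointwise intersection of a chain of families of finite sets is
    attained, over finitely many indices, by one member of the chain; this is
    where the finiteness of the sets replaces a compactness argument. *)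
Lemma hall_minimal A0 : hall A0 ->
  exists A, [/\ hall A, (forall i, A i `<=` A0 i)%fset & forall B, hall B ->
    (forall i, B i `<=` A i)%fset -> forall i, (A i `<=` B i)%fset].
Proof.
move=> hA0; pose ok A := hall A /\ forall i, (A i `<=` A0 i)%fset.
have ok0 : ok A0 by split.
pose R (s t : {A | ok A}) : bool := `[< forall i, (sval t i `<=` sval s i)%fset >].
have [| | |A maxA] := @ZL_preorder _ (exist _ A0 ok0) R.
- by move=> s; apply/asboolP => i; exact: fsubset_refl.
- move=> r s t /asboolP rs /asboolP st.
  by apply/asboolP => i; exact: fsubset_trans (st i) (rs i).
- move=> S totS.
  have [[c0 Sc0]|S0] := pselect (S !=set0); last first.
    by exists (exist _ A0 ok0) => s Ss; exfalso; apply: S0; exists s.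
  have /choice[c cP] i : exists c, S c /\
      forall s, S s -> (sval c i `<=` sval s i)%fset.
    pose P n := `[< exists2 s, S s & #|` sval s i| = n >].
    have exP : exists n, P n by exists #|` sval c0 i|; apply/asboolP; exists c0.
    have [n /asboolP[s Ss sn] nmin] := ex_minnP exP.
    exists s; split => // t St; have [/asboolP st|/asboolP ts] := totS _ _ Ss St.
      have /nmin tn : P #|` sval t i| by apply/asboolP; exists t.
      have := st i; rewrite fsubEproper => /orP[/eqP->//|/fproper_ltn_card].
      by rewrite sn ltnNge tn.
    exact: ts.
  have okB : ok (fun i => sval (c i) i).
    split=> [J|i]; last exact: (svalP (c i)).2.
    have [s Ss sJ] : exists2 s, S s &
        forall i, i \in (J : seq I) -> (sval s i `<=` sval (c i) i)%fset.
      elim: (J : seq I) => [|i l [s Ss IH]]; first by exists c0.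
      have [/asboolP si|/asboolP si] := totS _ _ Ss (cP i).1.
        exists (c i); first exact: (cP i).1.
        move=> j; rewrite inE => /orP[/eqP->|jl]; first exact: fsubset_refl.
        exact: fsubset_trans (si j) (IH j jl).
      exists s => // j; rewrite inE => /orP[/eqP->|]; [exact: si|exact: IH].
    exact: leq_trans ((svalP s).1 J) (fsubset_leq_card (fcupsS sJ)).
  by exists (exist _ _ okB) => s Ss; apply/asboolP => i; apply: (cP i).2.
- exists (sval A); split; [exact: (svalP A).1|exact: (svalP A).2|].
  move=> B hB BA i.
  have okB : ok B.
    by split => // j; exact: fsubset_trans (BA j) ((svalP A).2 j).
  have /asboolP : R (exist _ B okB) A; last exact.
  by apply: maxA; apply/asboolP.
Qed.

(** Rado's argument: in a minimal family, deleting either of two points [x],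
    [y] of [A i] breaks the condition at some finite sets of indices, and
    counting unions and intersections at these contradicts the condition for
    [A].  Hence the members of a minimal family are singletons. *)
Lemma hall_injection A0 : hall A0 ->
  exists f : I -> T, injective f /\ forall i, f i \in A0 i.
Proof.
move=> /hall_minimal[A [hA AA0 minA]].
have breaks i x : x \in A i -> exists2 J : {fset I}, i \notin J &
    (#|` \bigcup_(j <- J) A j `|` (A i `\ x)|%fset <= #|` J|)%N.
  move=> xA; pose Ax j := if j == i then (A i `\ x)%fset else A j.
  have nhAx : ~ hall Ax.
    move=> /minA H; have : (A i `<=` Ax i)%fset.
      apply: H => j; rewrite /Ax; case: eqP => [->|_]; last exact: fsubset_refl.
      exact: fsubD1set.
    by rewrite /Ax eqxx => /fsubsetP/(_ x xA); rewrite !inE eqxx.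
  have [J ltJ] : exists J : {fset I}, (#|` \bigcup_(j <- J) Ax j|%fset < #|` J|)%N.
    apply: contrapT => H; apply: nhAx => J; rewrite leqNgt; apply/negP => JJ.
    by apply: H; exists J.
  have iJ : i \in J.
    apply: contraT => iJ; move: ltJ; rewrite ltnNge => /negP[].
    apply: leq_trans (hA J) (fsubset_leq_card (fcupsS _)) => j jJ.
    rewrite /Ax; case: eqP => [ji|_]; last exact: fsubset_refl.
    by move: iJ; rewrite -ji jJ.
  exists (J `\ i)%fset; first by rewrite !inE eqxx.
  move: ltJ; rewrite (cardfsD1 i J) iJ add1n ltnS; apply: leq_trans.
  apply: fsubset_leq_card; apply/fsubsetP => y; rewrite inE => /orP[|yA].
    move=> /bigfcupP[j /andP[]]; rewrite !inE => /andP[ji jJ] _ yj.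
    by apply/bigfcupP; exists j; rewrite ?jJ// /Ax (negbTE ji).
  by apply/bigfcupP; exists i; rewrite ?iJ// /Ax eqxx.
have single i : exists x, A i = [fset x]%fset.
  have [/eqP/cardfs1P[x ->]|n1] := pselect (#|` A i| = 1%N); first by exists x.
  have A_gt0 : (0 < #|` A i|)%N.
    have := hA [fset i]%fset; rewrite cardfs1.
    suff -> : (\bigcup_(j <- [fset i]) A j)%fset = A i by [].
    by rewrite big_seq_fset1.
  have [x xA] : exists x, x \in A i by apply/fset0Pn; rewrite -cardfs_gt0.
  have [y] : exists y, y \in (A i `\ x)%fset.
    apply/fset0Pn; rewrite -cardfs_gt0; move: A_gt0 n1.
    by rewrite (cardfsD1 x) xA; case: #|` _|.
  rewrite !inE => /andP[yx yA]; exfalso.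
  have [J iJ ltJ] := breaks i x xA; have [K iK ltK] := breaks i y yA.
  set P := (_ `|` _)%fset in ltJ; set Q := (_ `|` _)%fset in ltK.
  have := leq_add ltJ ltK; rewrite -cardfsUI -(cardfsUI J K); apply/negP.
  rewrite -ltnNge -addSn; apply: leq_add.
    apply: leq_trans (_ : #|` i |` (J `|` K)|%fset <= _)%N.
      by rewrite cardfsU1 !inE negb_or iJ iK.
    apply: leq_trans (hA _) (fsubset_leq_card _); apply/fsubsetP => z.
    move=> /bigfcupP[j]; rewrite andbT !inE => /orP[/eqP->|/orP[jJ|jK]] zA.
    - have [zx|zx] := eqVneq z x; last by rewrite zA !orbT.
      by rewrite zx (eq_sym x) yx xA !orbT.
    - by apply/orP; left; apply/orP; left; apply/bigfcupP; exists j; rewrite ?jJ.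
    - by apply/orP; right; apply/orP; left; apply/bigfcupP; exists j; rewrite ?jK.
  apply: leq_trans (hA _) (fsubset_leq_card _); apply/fsubsetP => z.
  move=> /bigfcupP[j]; rewrite andbT !inE => /andP[jJ jK] zA.
  apply/andP; split; apply/orP; left; apply/bigfcupP; exists j => //;
    by rewrite ?jJ ?jK.
have [f fA] := choice single; exists f; split => [i j fij|i]; last first.
  by apply: (fsubsetP (AA0 i)); rewrite fA inE.
apply: contrapT => /eqP ij; have := hA [fset i; j]%fset.
rewrite cardfs2 ij leqNgt => /negP; apply; rewrite ltnS.
apply: leq_trans (_ : #|` [fset f i]%fset| <= _)%N; last by rewrite cardfs1.
apply: fsubset_leq_card; apply/fsubsetP => x.
move=> /bigfcupP[k]; rewrite andbT fA !inE => /orP[]/eqP->; last by rewrite fij.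
by [].
Qed.

End Hall.

(** * Folner sets from an invariant mean *)

Section Folner.
Context {R : realType} {G : groupType}.
Implicit Types K F : {fset G}.

Definition mulfs K F := [fset (k * f)%g | k in K, f in F]%fset.

Lemma mulfsP K F x :
  reflect (exists2 k, k \in K & exists2 f, f \in F & x = (k * f)%g) (x \in mulfs K F).
Proof.
apply: (iffP (imfset2P _ _ _ _ _)) => /=.
  by move=> [k kK [f fF ->]]; exists k => //; exists f.
by move=> [k kK [f fF ->]]; exists k => //; exists f.
Qed.

(** If every finite set were to grow by a definite factor under [K], some
    finite [L] would double all of them; the condition of Hall's theorem then
    holds for two copies of each [g] with the choices [L g], and an injective
    choice is a paradoxical decomposition of [G], of total mass 2 for any
    mean. *)
Lemma amenable_folner : amenable R G -> forall K (d : R), 0 < d ->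
  exists2 F, F != fset0 & #|` mulfs K F `\` F|%fset%:R < d * #|` F|%:R.
Proof.
move=> [m [m_ge0 m1 mU mM]] K d d0; apply: contrapT => noF.
have grow F : F != fset0 -> d * #|` F|%:R <= #|` mulfs K F `\` F|%fset%:R.
  by move=> F0; rewrite leNgt; apply/negP => H; apply: noF; exists F.
pose K1 := (1%g |` K)%fset.
(* Adding 1 to [K] makes the translates increase, so that the growth can be
   iterated. *)
have grow1 F : F != fset0 -> (1 + d) * #|` F|%:R <= #|` mulfs K1 F|%:R :> R.
  move=> F0; rewrite -(cardfsID F (mulfs K1 F)) natrD mulrDl mul1r lerD//.
    rewrite ler_nat; apply: fsubset_leq_card; apply/fsubsetP => x xF.
    rewrite inE xF andbT; apply/mulfsP; exists 1%g; first by rewrite !inE eqxx.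
    by exists x; rewrite ?mul1g.
  apply: le_trans (grow F F0) _; rewrite ler_nat; apply: fsubset_leq_card.
  apply: fsetSD; apply/fsubsetP => x /mulfsP[k kK [f fF ->]].
  by apply/mulfsP; exists k; rewrite ?inE ?kK ?orbT//; exists f.
have mulfs_neq0 n F : F != fset0 -> iter n (mulfs K1) F != fset0.
  move=> F0; elim: n => //= n /fset0Pn[x xF]; apply/fset0Pn; exists x.
  apply/mulfsP; exists 1%g; first by rewrite !inE eqxx.
  by exists x; rewrite ?mul1g.
have [L doubling] : exists L, forall F, (2 * #|` F| <= #|` mulfs L F|)%N.
  have [n n_gt] : exists n : nat, 1 <= n%:R * d.
    exists (Num.trunc d^-1).+1; rewrite -ler_pdivrMr// mul1r.
    by rewrite ltW// truncnS_gt.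
  exists (iter n (mulfs K1) [fset 1%g]%fset) => F.
  have [->|F0] := eqVneq F fset0; first by rewrite cardfs0 muln0.
  have -> : mulfs (iter n (mulfs K1) [fset 1%g]%fset) F = iter n (mulfs K1) F.
    elim: n {n_gt} => /= [|n <-]; apply/fsetP => x.
      apply/mulfsP/idP => [[k]|xF].
        by rewrite inE => /eqP-> [f fF ->]; rewrite mul1g.
      by exists 1%g; rewrite ?inE//; exists x; rewrite ?mul1g.
    apply/mulfsP/mulfsP.
      move=> [k /mulfsP[l lK [h hK ->]] [f fF ->]]; exists l => //.
      by exists (h * f)%g; rewrite ?mulgA//; apply/mulfsP; exists h => //; exists f.
    move=> [l lK [h /mulfsP[k kK [f fF ->]] ->]]; exists (l * k)%g.
      by apply/mulfsP; exists l => //; exists k.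
    by exists f; rewrite ?mulgA.
  rewrite -(ler_nat R) natrM; apply: le_trans (_ : (1 + n%:R * d) * #|` F|%:R <= _).
    by rewrite ler_wpM2r//; lra.
  elim: n {n_gt} => [|n IH]; first by rewrite mul0r addr0 mul1r.
  apply: le_trans (grow1 _ (mulfs_neq0 n F F0)).
  have ab : #|` F|%:R <= #|` iter n (mulfs K1) F|%:R :> R.
    apply: le_trans IH; rewrite -{1}[_%:R]mul1r ler_wpM2r// lerDl.
    by rewrite mulr_ge0// ltW.
  move: IH (ler_wpM2l (ltW d0) ab); rewrite -natr1.
  set a := #|` F|%:R; set b := #|` _|%:R => IH dab.
  by nra.
have [f [f_inj fL]] : exists f : G * bool -> G,
    injective f /\ forall p, f p \in mulfs L [fset p.1]%fset.
  apply: hall_injection => J.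
  pose F := [fset p.1 | p in J]%fset.
  have JF : (#|` J| <= 2 * #|` F|)%N.
    rewrite mulnC -(size_allpairs pair (enum_fset F) [:: true; false]).
    apply: uniq_leq_size (fset_uniq J) _ => -[g b] gbJ.
    apply/allpairsP; exists (g, b); split=> //; last by case: b {gbJ}.
    by apply/imfsetP; exists (g, b).
  apply: leq_trans JF (leq_trans (doubling F) (fsubset_leq_card _)).
  apply/fsubsetP => x /mulfsP[k kL [_ /imfsetP[/= p pJ ->] ->]].
  apply/bigfcupP; exists p; rewrite ?pJ//; apply/mulfsP; exists k => //.
  by exists p.1; rewrite ?inE.
pose E b k : set G := [set g | f (g, b) = (k * g)%g].
pose M b k : set G := (fun h => (k * h)%g) @` E b k.
have m_bigcup (I : choiceType) (s : seq I) (A : I -> set G) : uniq s ->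
    (forall i j, A i `&` A j !=set0 -> i = j) ->
    m [set g | exists2 i, i \in s & A i g] = \sum_(i <- s) m (A i).
  move=> us dA; elim: s us => [_|i s IH /= /andP[nis us]].
    rewrite big_nil (_ : [set _ | _] = set0); last by apply/seteqP; split => // g [? //].
    have := mU set0 set0 (setI0 _); rewrite setU0 => /eqP.
    by rewrite -subr_eq0 opprD addrA subrr add0r oppr_eq0 => /eqP.
  rewrite big_cons -IH// -mU.
    congr m; apply/seteqP; split => g /=.
      move=> [j]; rewrite inE => /orP[/eqP->|js] Ajg; first by left.
      by right; exists j.
    move=> [Aig|[j js Ajg]]; first by exists i; rewrite ?inE ?eqxx.
    by exists j; rewrite ?inE ?js ?orbT.
  rewrite -subset0 => g [Aig [j js Ajg]].
  by move: nis; rewrite (dA i j) ?js//; exists g.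
have Ecover b : \sum_(k <- L) m (E b k) = 1.
  rewrite -m_bigcup//.
    rewrite -[RHS]m1; congr m; apply/seteqP; split => // g _ /=.
    have /mulfsP[k kL [h]] := fL (g, b); rewrite inE => /eqP-> fk.
    by exists k.
  by move=> k l [g []]; rewrite /E/= => -> /mulIg.
have m_le1 A : m A <= 1 by rewrite -m1 -(setUv A) mU ?setICr// lerDl.
pose BL := [seq (b, k) | b <- [:: true; false], k <- enum_fset L].
have := m_le1 [set g | exists2 p, p \in BL & M p.1 p.2 g].
rewrite m_bigcup.
- rewrite big_allpairs_dep/= !big_cons big_nil addr0.
  under eq_bigr do rewrite mM.
  under [X in _ + X]eq_bigr do rewrite mM.
  by rewrite !Ecover; lra.
- by apply: allpairs_uniq => // -[b k] [c l].
- move=> [b k] [c l] [g [[h /= fh kh] [h' /= fh' kh']]].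
  have [hh' bc] : (h, b) = (h', c) by apply: f_inj; rewrite fh fh' kh kh'.
  by move: kh'; rewrite -hh' bc -kh => /mulIg->.
Qed.

End Folner.

(** * Topological preliminaries *)

(** The covering characterization of compactness, for spaces that need not
    carry a distinguished point. *)
Lemma compact_finite_cover (X : topologicalType) (A : set X) (I : choiceType)
    (f : I -> set X) : compact A -> (forall i, open (f i)) ->
  A `<=` \bigcup_i f i -> exists D : {fset I}, A `<=` \bigcup_(i in [set` D]) f i.
Proof.
move=> cA oF Af; apply: contrapT => noD.
pose F := filter_from [set: {fset I}] (fun D => A `\` \bigcup_(i in [set` D]) f i).
have FF : ProperFilter F.
  apply: filter_from_proper.
    apply: filter_from_filter; first by exists fset0.
    move=> D E _ _; exists (D `|` E)%fset => // x [Ax nx].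
    by split; split => // -[i /= iD fix_]; apply: nx; exists i => //=;
      rewrite inE iD ?orbT.
  move=> D _; apply: contrapT => D0; apply: noD; exists D => x Ax.
  by apply: contrapT => nx; apply: D0; exists x.
have FA : F A by exists fset0 => // x [].
have [p [Ap clFp]] := cA F FF FA; have [i _ fip] := Af p Ap.
have Ffi : F (A `\` f i).
  exists [fset i]%fset => // x [Ax nx]; split => // fix_; apply: nx.
  by exists i => //=; rewrite inE.
have [x [[_ nfi] fi]] := clFp _ _ Ffi (open_nbhs_nbhs (conj (oF i) fip)).
exact: nfi fi.
Qed.

Section Topology.
Context {R : realType} {X : metricType R}.
Implicit Types A B C U V : set X.

Lemma normal_between A U : closed A -> open U -> A `<=` U ->
  exists W, [/\ open W, A `<=` W & closure W `<=` U].
Proof.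
move=> clA oU AU.
have /set_nbhsP nAU : exists C, [/\ open C, A `<=` C & C `<=` U] by exists U; split.
have [B /set_nbhsP[W [oW AW WB]] clBU] := pseudometric_normal clA nAU.
exists W; split => //; exact: subset_trans (closureS WB) clBU.
Qed.

Lemma open_image (f g : X -> X) : continuous g -> cancel f g -> cancel g f ->
  forall U, open U -> open (f @` U).
Proof.
move=> cg fK gK U oU; rewrite (_ : f @` U = g @^-1` U).
  by apply: open_comp => // x _; exact: cg.
by apply/seteqP; split => [_ [x Ux <-]/=|x /= Ux]; [rewrite fK|exists (g x)].
Qed.

Lemma closed_image (f g : X -> X) : continuous g -> cancel f g -> cancel g f ->
  forall C, closed C -> closed (f @` C).
Proof.
move=> cg fK gK C clC; rewrite (_ : f @` C = g @^-1` C).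
  by apply: closed_comp => // x _; exact: cg.
by apply/seteqP; split => [_ [x Cx <-]/=|x /= Cx]; [rewrite fK|exists (g x)].
Qed.

End Topology.

(** * From a finitely additive probability to a Borel probability *)

Section ContentMeasure.
Context {R : realType} {X : metricType R}.
Hypothesis X_compact : compact [set: X].
Variable nu : set X -> R.
Hypothesis nu_ge0 : forall A, 0 <= nu A.
Hypothesis nu_setT : nu setT = 1.
Hypothesis nuU : forall A B, A `&` B = set0 -> nu (A `|` B) = nu A + nu B.
Implicit Types A B C U V : set X.
Local Open Scope ereal_scope.

Lemma content0 : nu set0 = 0%R.
Proof. by have := nuU (setI0 set0); rewrite setU0; lra. Qed.

Lemma content_le A B : A `<=` B -> (nu A <= nu B)%R.
Proof.
move=> AB; rewrite -(setDUK AB) nuU ?lerDl//.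
by rewrite setDE setICA setICr setI0.
Qed.

Lemma content_subadd A B : (nu (A `|` B) <= nu A + nu B)%R.
Proof.
have -> : A `|` B = A `|` (B `\` A) by rewrite setDE setUIr setUCr setIT.
rewrite nuU; first by rewrite lerD2l; apply: content_le; exact: subDsetl.
by rewrite setDE setICA setICr setI0.
Qed.

Definition inner U : \bar R :=
  ereal_sup [set (nu C)%:E | C in [set C | closed C /\ C `<=` U]].

Definition outer A : \bar R :=
  ereal_inf [set inner U | U in [set U | open U /\ A `<=` U]].

Lemma inner_ge C U : closed C -> C `<=` U -> (nu C)%:E <= inner U.
Proof. by move=> clC CU; apply: ereal_sup_ubound; exists C. Qed.

Lemma inner_le U c : (forall C, closed C -> C `<=` U -> (nu C)%:E <= c) ->
  inner U <= c.
Proof. by move=> H; apply: ge_ereal_sup => _ [C [clC CU] <-]; exact: H. Qed.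

Lemma inner_le_content U : inner U <= (nu U)%:E.
Proof. by apply: inner_le => C _ CU; rewrite lee_fin content_le. Qed.

Lemma inner_ge0 U : 0 <= inner U.
Proof.
apply: (@le_trans _ _ (nu set0)%:E); first by rewrite lee_fin.
by apply: inner_ge => //; exact: closed0.
Qed.

Lemma inner_fin U : inner U \is a fin_num.
Proof.
rewrite ge0_fin_numE ?inner_ge0//.
exact: le_lt_trans (inner_le_content U) (ltry _).
Qed.

Lemma innerS U V : U `<=` V -> inner U <= inner V.
Proof.
move=> UV; apply: inner_le => C clC CU; apply: inner_ge => //.
exact: subset_trans CU UV.
Qed.

(** A closed set in a union of two open sets is a union of closed subsets of
    each of them, by normality. *)
Lemma innerU U V : open U -> open V -> inner (U `|` V) <= inner U + inner V.
Proof.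
move=> oU oV; apply: inner_le => C clC CUV.
have clCU : closed (C `\` U) by apply: closedI => //; exact: open_closedC.
have CUinV : C `\` U `<=` V by move=> x [/CUV[]].
have [W [oW CUW WV]] := normal_between clCU oV CUinV.
apply: (@le_trans _ _ ((nu (C `\` W))%:E + (nu (C `&` closure W))%:E)).
  rewrite -EFinD lee_fin; apply: le_trans (content_subadd _ _).
  apply: content_le => x Cx; have [Wx|nWx] := pselect (W x); last by left.
  by right; split => //; exact: subset_closure.
apply: leeD; apply: inner_ge.
- by apply: closedI => //; exact: open_closedC.
- by move=> x [Cx nWx]; apply: contrapT => nUx; exact/nWx/CUW.
- by apply: closedI => //; exact: closed_closure.
- by move=> x [_ /WV].
Qed.

Lemma inner_bigcup (U : nat -> set X) : (forall n, open (U n)) ->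
  inner (\bigcup_n U n) <= \sum_(n <oo) inner (U n).
Proof.
move=> oU; apply: inner_le => C clC CU.
have : compact C by exact: subclosed_compact clC X_compact _.
move=> /compact_finite_cover /(_ oU CU)[D CD].
pose N := (\max_(i <- enum_fset D) i).+1.
have CN : C `<=` \big[setU/set0]_(i < N) U i.
  move=> x /CD[i /= iD Uix]; rewrite -bigcup_mkord; exists i => //=.
  by rewrite ltnS; apply: leq_bigmax_seq.
apply: (@le_trans _ _ (inner (\big[setU/set0]_(i < N) U i))).
  exact: inner_ge.
apply: (@le_trans _ _ (\sum_(0 <= i < N) inner (U i))); last first.
  by apply: nneseries_lim_ge => n _ _; exact: inner_ge0.
elim: N {CN} => [|n IH].
  rewrite big_ord0 big_nil; apply: inner_le => D' _; rewrite subset0 => ->.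
  by rewrite content0.
rewrite big_ord_recr big_nat_recr//=; apply: le_trans (innerU _ _) _ => //.
  by apply: big_ind => //; [exact: open0|exact: openU].
exact: leeD2r.
Qed.

Lemma outer_open U : open U -> outer U = inner U.
Proof.
move=> oU; apply/eqP; rewrite eq_le; apply/andP; split.
  by apply: ereal_inf_lbound; exists U => //; split.
by apply: le_ereal_inf_tmp => _ [V [_ UV] <-]; exact: innerS.
Qed.

Lemma outer_ge0 A : 0 <= outer A.
Proof. by apply: le_ereal_inf_tmp => _ [V _ <-]; exact: inner_ge0. Qed.

Lemma outerS A B : A `<=` B -> outer A <= outer B.
Proof.
move=> AB; apply: le_ereal_inf_tmp => _ [V [oV BV] <-].
by apply: ereal_inf_lbound; exists V => //; split=> //; exact: subset_trans BV.
Qed.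

Lemma outer0 : outer set0 = 0.
Proof.
rewrite outer_open; last exact: open0.
apply/eqP; rewrite eq_le inner_ge0 andbT; apply: inner_le => C _; rewrite subset0 => ->.
by rewrite content0.
Qed.

Lemma outer_fin A : outer A \is a fin_num.
Proof.
rewrite ge0_fin_numE ?outer_ge0//; apply: le_lt_trans (outerS (@subsetT _ A)) _.
by rewrite outer_open; [rewrite -ge0_fin_numE ?inner_ge0 ?inner_fin|exact: openT].
Qed.

Lemma outer_approx A (e : R) : (0 < e)%R ->
  exists U, [/\ open U, A `<=` U & inner U <= outer A + e%:E].
Proof.
move=> e0; have [_ [U [oU AU] <-] lt] := lb_ereal_inf_adherent e0 (outer_fin A).
by exists U; split => //; exact: ltW.
Qed.

Lemma outer_sigma_subadditive : sigma_subadditive outer.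
Proof.
move=> F; apply/lee_addgt0Pr => _/posnumP[e].
have /choice[U UP] n := @outer_approx (F n) (e%:num / (2 ^ n.+1)%:R)%R ltac:(by []).
have oU n : open (U n) by case: (UP n).
apply: (@le_trans _ _ (outer (\bigcup_n U n))).
  by apply: outerS => x [n _ Fx]; exists n => //; case: (UP n) => _ + _; apply.
rewrite outer_open; last exact: bigcup_open.
apply: le_trans (inner_bigcup oU) _.
have F_ge0 n : 0 <= outer (F n) by exact: outer_ge0.
apply: le_trans (epsilon_trick xpredT F_ge0 _); last by [].
apply: lee_nneseries => n _; first by move=> _; exact: inner_ge0.
by case: (UP n).
Qed.

HB.instance Definition _ := isOuterMeasure.Build R X outer
  outer0 outer_ge0 outerS outer_sigma_subadditive.

(** By outer regularity it is enough to split an open [V]; a closed subset of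
    [V `&` U] and a closed subset of its complement in [V] are disjoint, so that
    additivity of [nu] applies to them. *)
Lemma open_caratheodory U : open U -> outer.-caratheodory U.
Proof.
move=> oU; apply: le_caratheodory_measurable => A.
apply/lee_addgt0Pr => _/posnumP[e].
have [V [oV AV Vle]] := @outer_approx A e%:num ltac:(by []).
apply: le_trans Vle.
apply: (@le_trans _ _ (inner (V `&` U) + outer (V `\` U))).
  apply: leeD; last by apply: outerS; exact: setSI.
  rewrite -outer_open; last exact: openI.
  by apply: outerS; exact: setSI.
rewrite -leeBrDr ?outer_fin//; apply: inner_le => C clC CVU.
rewrite leeBrDr ?outer_fin// addeC -leeBrDr//.
apply: (@le_trans _ _ (inner (V `\` C))).
  rewrite -outer_open; last by apply: openI => //; exact: closed_openC.
  by apply: outerS => x [Vx nUx]; split => // /CVU[].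
apply: inner_le => D clD DVC.
rewrite leeBrDr// addeC -EFinD -nuU; last first.
  by rewrite -subset0 => x [Cx /DVC[]].
apply: inner_ge; first exact: closedU.
by move=> x [/CVU[]|/DVC[]].
Qed.

(** Inner regularization on open sets followed by outer regularization turns a
    finitely additive probability on all subsets of a compact metric space
    into a Borel probability.  It can only gain mass on closed sets and lose
    mass on open ones. *)
Lemma content_probability (x0 : X) : exists P : probability (borelType x0) R,
  [/\ forall C, closed C -> (nu C)%:E <= P C,
      forall U, open U -> P U <= (nu U)%:E
    & forall f g : X -> X, continuous f -> continuous g -> cancel f g ->
        cancel g f -> (forall A, nu (f @` A) = nu A) ->
        forall A, P (f @` A) = P A].
Proof.
pose mu : set (borelType x0) -> \bar R := outer.
have borel_cara (A : set (borelType x0)) : measurable A -> outer.-caratheodory A.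
  apply: smallest_sub; last by move=> U oU; exact: open_caratheodory.
  split => [|A'|F mF].
  - exact: caratheodory_measurable_set0.
  - by rewrite setTD; exact: caratheodory_measurable_setC.
  - exact: caratheodory_measurable_bigcup.
have mu_sigma : semi_sigma_additive mu.
  move=> F mF tF mbF.
  apply: (@caratheodory_measure_sigma_additive R (pointed_at x0) outer F) => //.
    by move=> n; exact: borel_cara.
  exact: borel_cara.
pose m := isMeasure.Build _ (borelType x0) R mu outer0 outer_ge0 mu_sigma.
pose M : {measure set (borelType x0) -> \bar R} := HB.pack mu m.
have M1 : M setT = 1.
  rewrite /= /mu outer_open; last exact: openT.
  apply/eqP; rewrite eq_le; apply/andP; split.
    by apply: le_trans (inner_le_content _) _; rewrite nu_setT.
  by rewrite -[X in X <= _]/(1%R%:E) -nu_setT; apply: inner_ge => //; exact: closedT.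
pose p := Measure_isProbability.Build _ (borelType x0) R M M1.
pose P : probability (borelType x0) R := HB.pack (Measure.sort M) p.
exists P; split.
- move=> C clC; apply: le_ereal_inf_tmp => _ [U [oU CU] <-]; exact: inner_ge.
- by move=> U oU; rewrite /= /mu outer_open//; exact: inner_le_content.
- have half (f g : X -> X) : continuous f -> continuous g -> cancel f g ->
      cancel g f -> (forall A, nu (f @` A) = nu A) ->
      forall A, outer (f @` A) <= outer A.
    move=> cf cg fK gK nuf A; apply: le_ereal_inf_tmp => _ [U [oU AU] <-].
    apply: (@le_trans _ _ (inner (f @` U))).
      apply: ereal_inf_lbound; exists (f @` U) => //; split.
        exact: open_image cg fK gK _ oU.
      exact: image_subset.
    apply: inner_le => C clC CfU.
    have -> : nu C = nu (g @` C).
      by rewrite -[RHS]nuf image_comp (_ : f \o g = id) ?image_id//; apply/funext => x /=.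
    apply: inner_ge; first exact: closed_image cf gK fK _ clC.
    by move=> _ [y /CfU[z Uz <-] <-]; rewrite fK.
  move=> f g cf cg fK gK nuf A; apply/eqP; rewrite eq_le; apply/andP; split.
    exact: half cf cg fK gK nuf A.
  have gf B : g @` (f @` B) = B.
    by rewrite image_comp (_ : g \o f = id) ?image_id//; apply/funext => x /=.
  have fg B : f @` (g @` B) = B.
    by rewrite image_comp (_ : f \o g = id) ?image_id//; apply/funext => x /=.
  rewrite -{1}(gf A); apply: half cg cf gK fK _ _ => B.
  by rewrite -nuf fg.
Qed.

End ContentMeasure.

(** * Invariant measures *)

Section Action.
Context {R : realType} {G : groupType} {X : metricType R}.
Variable a : continuous_action G X.
Implicit Types (g h : G) (A B C U V : set X) (F K S : {fset G}).

Lemma actK g : cancel (a g) (a g^-1%g).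
Proof. by move=> x; rewrite -actM mulVg act1. Qed.

Lemma actVK g : cancel (a g^-1%g) (a g).
Proof. by move=> x; rewrite -actM mulgV act1. Qed.

Lemma act_imageE g A x : (a g @` A) x <-> A (a g^-1%g x).
Proof.
split=> [[y Ay <-]|Ax]; first by rewrite actK.
by exists (a g^-1%g x); rewrite ?actVK.
Qed.

Lemma act_image_preimage g A : a g @` A = a g^-1%g @^-1` A.
Proof. by apply/funext => x; apply/propext; exact: act_imageE. Qed.

Lemma act_image1 A : a 1%g @` A = A.
Proof.
by rewrite act_image_preimage; apply/seteqP; split => x /=; rewrite invg1 act1.
Qed.

Lemma act_imageM g h A : a (g * h)%g @` A = a g @` (a h @` A).
Proof. by rewrite image_comp; apply: eq_imagel => x _ /=; rewrite actM. Qed.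

Lemma act_imageI g A B : a g @` (A `&` B) = a g @` A `&` a g @` B.
Proof. by rewrite !act_image_preimage preimage_setI. Qed.

Lemma act_open g U : open U -> open (a g @` U).
Proof. exact: (open_image (@act_continuous _ _ a _) (actK g) (actVK g)). Qed.

(** The measurable sets of [borelType x0], without the choice of [x0]. *)
Definition borel A := <<s open >> A.

Lemma borel_open U : open U -> borel U.
Proof. exact: sub_sigma_algebra. Qed.

Lemma borelC A : borel A -> borel (~` A).
Proof. by move=> bA; rewrite -setTD; exact: sigma_algebraCD. Qed.

Lemma borel_closed C : closed C -> borel C.
Proof.
move=> clC; rewrite -[C]setCK; apply: borelC; apply: borel_open.
exact: closed_openC.
Qed.

Lemma borel0 : borel set0.
Proof. by apply: borel_open; exact: open0. Qed.

Lemma borelT : borel setT.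
Proof. by apply: borel_open; exact: openT. Qed.

Lemma borelU A B : borel A -> borel B -> borel (A `|` B).
Proof.
move=> bA bB; rewrite -bigcup2E; apply: sigma_algebra_bigcup => -[//|[//|n]].
exact: borel0.
Qed.

Lemma borelI A B : borel A -> borel B -> borel (A `&` B).
Proof.
move=> bA bB; rewrite -[A `&` B]setCK setCI; apply: borelC.
by apply: borelU; exact: borelC.
Qed.

Lemma borelD A B : borel A -> borel B -> borel (A `\` B).
Proof. by move=> bA bB; rewrite setDE; apply: borelI => //; exact: borelC. Qed.

Lemma borel_preimage g A : borel A -> borel (a g @^-1` A).
Proof.
pose D : set (set X) := [set A | borel (a g @^-1` A)].
suff : borel `<=` D by apply.
apply: smallest_sub => [|U oU].
  split => [|B DB|B DB].
  - by rewrite /D/= preimage_set0; exact: borel0.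
  - by rewrite /D/= setTD preimage_setC; exact: borelC.
  - by rewrite /D/= preimage_bigcup; exact: sigma_algebra_bigcup.
by apply: borel_open; apply: open_comp => // x _; exact: act_continuous.
Qed.

Lemma borel_act g A : borel A -> borel (a g @` A).
Proof. by rewrite act_image_preimage; exact: borel_preimage. Qed.

Lemma borel_bigcup_seq (I : choiceType) (s : seq I) (A : I -> set X) :
  (forall i, borel (A i)) -> borel (\bigcup_(i in [set` s]) A i).
Proof.
move=> bA; rewrite bigcup_seq; apply: big_ind => //; first exact: borel0.
exact: borelU.
Qed.

Section InvariantMeasure.
Variable mu : set X -> \bar R.
Hypothesis mu_inv : invariant_measures a mu.
Let m A : R := fine (mu A).

Lemma invm_fin A : borel A -> mu A = (m A)%:E.
Proof.
move=> bA; rewrite /m; have [x0 [P [-> _]]] := mu_inv.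
by rewrite fineK//; exact: fin_num_measure.
Qed.

Lemma invm_ge0 A : 0 <= m A.
Proof. by rewrite /m; have [x0 [P [-> _]]] := mu_inv; exact: fine_ge0. Qed.

Lemma invm0 : m set0 = 0.
Proof. by rewrite /m; have [x0 [P [-> _]]] := mu_inv; rewrite measure0. Qed.

Lemma invmT : m setT = 1.
Proof. by rewrite /m; have [x0 [P [-> _]]] := mu_inv; rewrite probability_setT. Qed.

Lemma invm_act g A : borel A -> m (a g @` A) = m A.
Proof. by move=> bA; rewrite /m; have [x0 [P [-> H]]] := mu_inv; rewrite H. Qed.

Lemma invm_preimage g A : borel A -> m (a g @^-1` A) = m A.
Proof. by move=> bA; rewrite -[g]invgK -act_image_preimage invm_act. Qed.

Lemma invmU A B : borel A -> borel B -> A `&` B = set0 ->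
  m (A `|` B) = m A + m B.
Proof.
move=> bA bB AB; have := invm_fin (borelU bA bB); move: (invm_fin bA) (invm_fin bB).
have : mu (A `|` B) = (mu A + mu B)%E.
  by have [x0 [P [-> _]]] := mu_inv; rewrite measureU.
by move=> -> -> ->; rewrite -EFinD => -[].
Qed.

Lemma invm_split A B : borel A -> borel B -> m A = m (A `&` B) + m (A `\` B).
Proof.
move=> bA bB; rewrite -invmU; [|exact: borelI|exact: borelD|].
  by rewrite setDE -setIUr setUCr setIT.
by rewrite setDE setIACA setICr setI0.
Qed.

Lemma invm_le A B : borel A -> borel B -> A `<=` B -> m A <= m B.
Proof.
move=> bA bB AB; rewrite (invm_split bB bA) (setIidr AB) lerDl; exact: invm_ge0.
Qed.

Lemma invmUle A B : borel A -> borel B -> m (A `|` B) <= m A + m B.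
Proof.
move=> bA bB; rewrite (invm_split (borelU bA bB) bA) setUK lerD2l.
apply: invm_le => //; first by apply: borelD => //; exact: borelU.
by move=> x [[]].
Qed.

Lemma invmC A : borel A -> m (~` A) = 1 - m A.
Proof.
by move=> bA; rewrite -invmT (invm_split borelT bA) setTI setTD addrAC subrr add0r.
Qed.

Lemma invm_le1 A : borel A -> m A <= 1.
Proof. by move=> bA; rewrite -invmT; apply: invm_le => //; exact: borelT. Qed.

Lemma invm_bigcup_le (I : choiceType) (s : seq I) (A : I -> set X) :
  (forall i, borel (A i)) ->
  m (\bigcup_(i in [set` s]) A i) <= \sum_(i <- s) m (A i).
Proof.
elim: s => [_|i s IH bA].
  by rewrite bigcup_seq !big_nil invm0.
rewrite bigcup_seq !big_cons -bigcup_seq.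
apply: le_trans (invmUle _ _) _.
- exact: bA.
- exact: borel_bigcup_seq.
- by rewrite lerD2l; exact: IH.
Qed.

Lemma invm_bigcup (I : choiceType) (s : seq I) (A : I -> set X) : uniq s ->
  (forall i, borel (A i)) -> trivIset [set` s] A ->
  m (\bigcup_(i in [set` s]) A i) = \sum_(i <- s) m (A i).
Proof.
elim: s => [_ _ _|i s IH /= /andP[nis us] bA tA].
  by rewrite bigcup_seq !big_nil invm0.
rewrite bigcup_seq !big_cons -bigcup_seq.
rewrite invmU; [|exact: bA|exact: borel_bigcup_seq|].
  by rewrite IH//; apply: sub_trivIset tA => j /= js; rewrite inE js orbT.
rewrite -subset0 => x [Aix [j /= js Ajx]].
have ij : i = j by apply: tA => /=; rewrite ?inE ?eqxx ?js ?orbT//; exists x.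
by move: nis; rewrite ij js.
Qed.

(** Integrating the number of sets that contain a point. *)
Lemma invm_count_ge (I : choiceType) (s : seq I) (A : I -> set X) E (c : R) :
  0 <= c -> borel E -> (forall i, borel (A i)) ->
  (forall x, E x -> c <= \sum_(i <- s) (`[< A i x >] : nat)%:R) ->
  c * m E <= \sum_(i <- s) m (E `&` A i).
Proof.
move=> c0 bE bA cE.
suff : (c%:E * mu E <= \sum_(i <- s) mu (E `&` A i))%E.
  rewrite invm_fin// -EFinM; under eq_bigr => i _ do rewrite (invm_fin (borelI bE (bA i))).
  by rewrite sumEFin lee_fin.
have [x0 [P [-> _]]] := mu_inv.
have mE : measurable (E : set (borelType x0)) by [].
have mA i : measurable (A i : set (borelType x0)) by exact: bA.
have mf i : measurable_fun (E : set (borelType x0))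
    (fun x : borelType x0 => (\1_(A i) x : R)%:E).
  by apply/measurable_EFinP; apply: measurable_funTS; exact: measurable_indic.
have f_ge0 i (x : borelType x0) : E x -> (0 <= (\1_(A i) x : R)%:E)%E.
  by move=> _; rewrite lee_fin indicE.
rewrite -(integral_cst P mE).
apply: (@le_trans _ _ (\int[P]_(x in E) \sum_(i <- s) (\1_(A i) x)%:E)%E).
  apply: ge0_le_integral => //.
  - by apply: emeasurable_sum => i.
  - move=> x Ex; rewrite sumEFin lee_fin; apply: le_trans (cE x Ex) _.
    apply: ler_sum => i _; rewrite indicE /= ler_nat.
    by case: asboolP => // Aix; rewrite mem_set.
rewrite ge0_integral_sum//; apply: lee_sum => i _.
by rewrite integral_indic// setIC.
Qed.

End InvariantMeasure.
End Action.

(** * Limits of empirical measures *)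

Section Empirical.
Context {R : realType} {G : groupType} {X : metricType R}.
Variable a : continuous_action G X.
Implicit Types (g h : G) (A B C U V : set X) (F K S : {fset G}).

Definition visits F x A : {fset G} := [fset s in F | `[< A (a s x) >]]%fset.

(** [emp F x] is the empirical measure of the orbit segment [F x]. *)
Definition emp F x A : R := #|` visits F x A|%:R / #|` F|%:R.

Lemma in_visits F x A s : (s \in visits F x A) = (s \in F) && `[< A (a s x) >].
Proof. by rewrite !inE. Qed.

Lemma visits_sub F x A : (visits F x A `<=` F)%fset.
Proof. exact: fset_sub. Qed.

Lemma visitsS F x A B : A `<=` B -> (visits F x A `<=` visits F x B)%fset.
Proof.
move=> AB; apply/fsubsetP => s; rewrite !in_visits => /andP[-> /asboolP /AB H].
exact/asboolP.
Qed.

Lemma card_visits F x A : #|` visits F x A| = (\sum_(s <- F) `[< A (a s x) >])%N.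
Proof.
have /perm_size -> : perm_eq (visits F x A) [seq s <- F | `[< A (a s x) >]].
  apply: uniq_perm; rewrite ?filter_uniq ?fset_uniq// => s.
  by rewrite mem_filter in_visits andbC.
by rewrite size_filter -sum1_count big_mkcond; apply: eq_bigr => s _; case: ifP.
Qed.

Lemma emp_ge0 F x A : 0 <= emp F x A.
Proof. by rewrite /emp divr_ge0. Qed.

Lemma emp_le1 F x A : emp F x A <= 1.
Proof.
rewrite /emp; have [->|F0] := eqVneq F fset0; first by rewrite cardfs0 invr0 mulr0.
rewrite ler_pdivrMr ?ltr0n ?cardfs_gt0// mul1r ler_nat.
exact/fsubset_leq_card/visits_sub.
Qed.

Lemma emp_le F x A B : A `<=` B -> emp F x A <= emp F x B.
Proof.
move=> AB; rewrite /emp ler_wpM2r ?invr_ge0// ler_nat.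
exact/fsubset_leq_card/visitsS.
Qed.

Lemma empT F x : F != fset0 -> emp F x setT = 1.
Proof.
move=> F0; rewrite /emp (_ : visits F x setT = F).
  by rewrite divff// pnatr_eq0 -lt0n cardfs_gt0.
by apply/fsetP => s; rewrite in_visits asboolT ?andbT.
Qed.

Lemma empU F x A B : A `&` B = set0 -> emp F x (A `|` B) = emp F x A + emp F x B.
Proof.
move=> AB; rewrite /emp -mulrDl -natrD -cardfsUI.
have -> : (visits F x A `&` visits F x B)%fset = fset0.
  apply/fsetP => s; rewrite inE !in_visits inE; apply/negP.
  move=> /andP[/andP[_ /asboolP As] /andP[_ /asboolP Bs]].
  by have : (A `&` B) (a s x) by []; rewrite AB.
rewrite cardfs0 addn0; congr (#|` _|%:R / _); apply/fsetP => s.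
rewrite inE !in_visits -andb_orr; congr (_ && _).
apply/asboolP/orP => [[H|H]|[/asboolP H|/asboolP H]].
- by left; apply/asboolP.
- by right; apply/asboolP.
- by left.
- by right.
Qed.

(** Translating [A] amounts to translating the set of times, which changes it
    little if [F] is almost invariant. *)
Lemma emp_act F x A g : F != fset0 ->
  emp F x (a g @` A) <=
  emp F x A + #|` mulfs [fset g^-1%g]%fset F `\` F|%fset%:R / #|` F|%:R.
Proof.
move=> F0; rewrite /emp -mulrDl ler_wpM2r ?invr_ge0// -natrD ler_nat.
have <- : #|` [fset (g^-1 * s)%g | s in visits F x (a g @` A)]%fset| =
    #|` visits F x (a g @` A)| by rewrite card_imfset//; exact: mulgI.
apply: (@leq_trans #|` visits F x A `|` (mulfs [fset g^-1%g] F `\` F)|%fset);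
  last by rewrite -cardfsUI leq_addr.
apply: fsubset_leq_card.
apply/fsubsetP => _ /imfsetP[/= s + ->]; rewrite in_visits => /andP[sF /asboolP].
move=> /act_imageE As; rewrite inE in_visits inE.
have [gsF|gsF] := boolP (_ \in F).
  by apply/orP; left; apply/asboolP; rewrite actM.
by apply/orP; right; apply/mulfsP; exists g^-1%g; rewrite ?inE//; exists s.
Qed.

Hypothesis X_compact : compact [set: X].

(** Weak-* compactness in elementary terms: along an ultrafilter, empirical
    measures of more and more invariant sets converge on every subset of [X]
    to an invariant, finitely additive probability, of which the regularization
    is an invariant Borel probability. *)
Lemma empirical_limit (T : Type) (Fl : set_system T) (PF : ProperFilter Fl)
    (F : T -> {fset G}) (x : T -> X) :
  (forall t, F t != fset0) ->
  (forall g (e : R), 0 < e -> \forall t \near Fl,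
     #|` mulfs [fset g]%fset (F t) `\` F t|%fset%:R <= e * #|` F t|%:R) ->
  exists2 mu, invariant_measures a mu &
    forall A B (c : R), closed A -> open B ->
      (\forall t \near Fl, emp (F t) (x t) B + c <= emp (F t) (x t) A) ->
      (mu B + c%:E <= mu A)%E.
Proof.
move=> F0 Finv; have [U [UU FlU]] := ultraFilterLemma PF.
pose e A t := emp (F t) (x t) A.
have /choice[nu nuP] A : exists l : R, e A @ U --> l.
  have cI : compact `[0, 1 : R]%classic by exact: segment_compact.
  have U01 : (e A @ U) `[0, 1 : R]%classic.
    by apply: (@filterE _ U) => t; rewrite /= in_itv /e /= emp_ge0 emp_le1.
  have [l [_ cl]] := cI _ _ U01; exists l => N Nl.
  have [//|nN] := in_ultra_setVsetC (e A @^-1` N) UU.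
  have nN' : (e A @ U) (~` N) by [].
  by have [r [/= nr Nr]] := cl _ _ nN' Nl.
have nuE A B (c : R) : (\forall t \near U, e B t + c <= e A t) -> nu B + c <= nu A.
  move=> BA; rewrite -subr_ge0.
  have lim : (fun t => e A t - (e B t + c)) @ U --> nu A - (nu B + c).
    exact: (cvgB (nuP A) (cvgD (nuP B) (cvg_cst c))).
  apply: (cvgr_to_ge lim); apply: filterS BA => t /=.
  by rewrite subr_ge0.
have nu_act_le g A : nu (a g @` A) <= nu A.
  apply/ler_addgt0Pr => d d0; rewrite -lerBlDr; apply: nuE.
  have := FlU _ (Finv g^-1%g d d0); apply: filterS => t td.
  rewrite lerBlDr; apply: le_trans (emp_act _ _ _ (F0 t)) _.
  by rewrite lerD2l ler_pdivrMr// ltr0n cardfs_gt0.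
have [t0 _] := @filter_ex _ _ PF setT filterT.
have [||A B AB|P [PC PO Pact]] := @content_probability R X X_compact nu _ _ _ (x t0).
- move=> A; apply: (cvgr_to_ge (nuP A)); apply: filterE => t.
  exact: emp_ge0.
- have lim1 : (fun=> 1 : R) @ U --> nu setT.
    rewrite (_ : (fun=> 1) = e setT); first exact: nuP.
    by apply/funext => t; rewrite /e empT.
  exact: cvg_unique lim1 (cvg_cst _).
- have : (e A \+ e B) @ U --> nu A + nu B by exact: (cvgD (nuP A) (nuP B)).
  rewrite (_ : e A \+ e B = e (A `|` B)); last first.
    by apply/funext => t; rewrite /e empU.
  by move=> lim; apply: (cvg_unique _ (nuP _) lim).
exists (P : set X -> \bar R).
  exists (x t0), P; split => // g A _; apply: (Pact (a g) (a g^-1%g)).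
  - exact: act_continuous.
  - exact: act_continuous.
  - exact: actK.
  - exact: actVK.
  - move=> B; apply/eqP; rewrite eq_le nu_act_le /=.
    rewrite -{1}(act_image1 a B) -(mulVg g) act_imageM; exact: nu_act_le.
move=> A B c clA oB BA.
apply: (@le_trans _ _ ((nu B)%:E + c%:E)%E); first by rewrite leeD2r// PO.
apply: le_trans (PC A clA); rewrite -EFinD lee_fin; apply: nuE; exact: FlU.
Qed.

End Empirical.

(** * The gap between measures is visible along orbits *)

Section Gap.
Context {R : realType} {G : groupType} {X : metricType R}.
Variable a : continuous_action G X.
Implicit Types (g h : G) (A B C U V : set X) (F K S : {fset G}).

Definition thicken (k : R) A : set X := [set x | exists2 y, A y & mdist y x < k].

Lemma sub_thicken k A : 0 < k -> A `<=` thicken k A.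
Proof. by move=> k0 x Ax; exists x; rewrite ?mdistxx. Qed.

Lemma thickenS k l A : k <= l -> thicken k A `<=` thicken l A.
Proof. by move=> kl x [y Ay yx]; exists y => //; exact: lt_le_trans kl. Qed.

Lemma closed_thicken C x : closed C ->
  (forall n, closure (thicken n.+1%:R^-1 C) x) -> C x.
Proof.
move=> clC cl; apply: clC => N /nbhs_ballP[e /= e0 eN].
have e2 : 0 < e / 2 by rewrite divr_gt0.
have [n _ /(_ n (leqnn n)) /= ne] := near_infty_natSinv_lt (PosNum e2).
have [z [[y Cy yz]]] := cl n _ (nbhsx_ballx x _ e2).
rewrite ballEmdist/= => xz; exists y; split => //; apply: eN.
rewrite ballEmdist/=; apply: le_lt_trans (metric_triangle x z y) _.
by rewrite (splitr e) ltrD// metric_sym (lt_trans yz).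
Qed.

(** Continuity from above: the closed neighbourhoods decrease to [C]. *)
Lemma invm_closure_thicken (mu : set X -> \bar R) C (d : R) :
  invariant_measures a mu -> closed C -> 0 < d ->
  \forall n \near \oo, fine (mu (closure (thicken n.+1%:R^-1 C))) <= fine (mu C) + d.
Proof.
move=> mu_inv clC d0.
pose F n := closure (thicken n.+1%:R^-1 C).
have bF n : borel (F n) by apply: borel_closed; exact: closed_closure.
have capF : \bigcap_n F n = C.
  apply/seteqP; split => [x Fx|x Cx n _].
    by apply: closed_thicken => // n; exact: Fx.
  exact/subset_closure/sub_thicken.
have niF : nonincreasing_seq F.
  move=> n k nk; apply/subsetPset; apply: closureS; apply: thickenS.
  by rewrite lef_pV2 ?posrE// ler_nat ltnS.
have cvgF : mu \o F @ \oo --> mu C.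
  have [x0 [P [-> _]]] := mu_inv; have -> : P C = P (\bigcap_n F n) by rewrite capF.
  apply: (@nonincreasing_cvg_mu _ (borelType x0) R P F) => //.
  - apply: le_lt_trans (ltry 1); apply: (@probability_le1 _ (borelType x0)); exact: bF.
  - by rewrite capF; exact: borel_closed.
have : (fun n => fine (mu (F n))) @ \oo --> fine (mu C).
  apply: (@fine_cvg _ _ _ _ (mu \o F)).
  by rewrite -(invm_fin mu_inv); last exact: borel_closed.
move=> /cvgrPdist_le/(_ d d0); apply: filterS => n /=.
by rewrite ler_norml => /andP[+ _]; rewrite lerBDl/= -/(F n); lra.
Qed.

Hypothesis X_compact : compact [set: X].

(** Were there no gap, some points and ever more invariant finite sets would
    violate it for ever smaller constants; a limit of their empirical measures
    would violate the hypothesis. *)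
Lemma uniform_gap A B (c : R) : closed A -> open B ->
  (forall mu, invariant_measures a mu -> (mu A + c%:E < mu B)%E) ->
  exists (e : R) K, 0 < e /\ forall F, F != fset0 ->
    (forall g, g \in K ->
       #|` mulfs [fset g]%fset F `\` F|%fset%:R <= e * #|` F|%:R) ->
    forall x, emp a F x (thicken e A) + c + e <= emp a F x (~` thicken e (~` B)).
Proof.
move=> clA oB ltAB; apply: contrapT => nogap.
have clCB : closed (~` B) by exact: open_closedC.
pose e (n : nat) : R := n.+1%:R^-1.
have e_gt0 n : 0 < e n by rewrite /e invr_gt0 ltr0n.
pose bad (p : nat * {fset G}) (q : {fset G} * X) := [/\ q.1 != fset0,
  (forall g, g \in p.2 ->
     #|` mulfs [fset g]%fset q.1 `\` q.1|%fset%:R <= e p.1 * #|` q.1|%:R) &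
  emp a q.1 q.2 (~` thicken (e p.1) (~` B)) <=
    emp a q.1 q.2 (thicken (e p.1) A) + c + e p.1].
have /choice[q badq] p : exists q, bad p q.
  apply: contrapT => nobad; apply: nogap; exists (e p.1), p.2; split=> // F F0 FK x.
  rewrite leNgt; apply/negP => lt; apply: nobad; exists (F, x).
  by split => //=; exact: ltW.
(* The counterexamples [q (n, K)] form a net as [n] and [K] increase. *)
pose above (p : nat * {fset G}) : set (nat * {fset G}) :=
  [set r | (p.1 <= r.1)%N /\ (p.2 `<=` r.2)%fset].
pose Fl := filter_from setT above.
have PF : ProperFilter Fl.
  apply: filter_from_proper; last by move=> p _; exists p; split.
  apply: filter_from_filter; first by exists (0%N, fset0).
  move=> p r _ _; exists (maxn p.1 r.1, (p.2 `|` r.2)%fset) => // s.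
  by move=> [/=]; rewrite geq_max fsubUset => /andP[? ?] /andP[? ?]; split.
have e_le n k : (n <= k)%N -> e k <= e n.
  by move=> nk; rewrite /e lef_pV2 ?posrE// ler_nat ltnS.
have [||mu mu_inv muP] := @empirical_limit R G X a X_compact _ Fl PF (fst \o q) (snd \o q).
- by move=> p /=; case: (badq p).
- move=> g d d0; have [n _ /(_ n (leqnn n)) /= nd] := near_infty_natSinv_lt (PosNum d0).
  exists (n, [fset g]%fset) => // p [/= np]; rewrite fsub1set => gp.
  have [_ /(_ g gp) + _] := badq p; move=> /le_trans; apply.
  by rewrite ler_wpM2r//; apply: le_trans (e_le _ _ np) (ltW nd).
pose m D := fine (mu D).
pose An n := closure (thicken (e n) A); pose Bn n := closure (thicken (e n) (~` B)).
have bAn n : borel (An n) by apply: borel_closed; exact: closed_closure.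
have bBn n : borel (Bn n) by apply: borel_closed; exact: closed_closure.
have step n : 1 - m (Bn n) <= m (An n) + c + e n.
  have : (mu (~` Bn n) + (- c - e n)%:E <= mu (An n))%E.
    apply: muP; [exact: closed_closure|by apply: closed_openC; exact: closed_closure|].
    exists (n, fset0) => // p [/= np _]; have [_ _ /= H] := badq p.
    have le1 : emp a (q p).1 (q p).2 (thicken (e p.1) A) <= emp a (q p).1 (q p).2 (An n).
      apply: emp_le; apply: subset_trans (@subset_closure _ _).
      by apply: thickenS; exact: e_le.
    have le2 : emp a (q p).1 (q p).2 (~` Bn n) <=
        emp a (q p).1 (q p).2 (~` thicken (e p.1) (~` B)).
      apply: emp_le; apply: subsetC; apply: subset_trans (@subset_closure _ _).
      by apply: thickenS; exact: e_le.
    by have := e_le _ _ np; lra.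
  rewrite (invm_fin mu_inv (borelC (bBn n))) (invm_fin mu_inv (bAn n)).
  by rewrite -EFinD lee_fin (invmC mu_inv)// -/(m (Bn n)) -/(m (An n)); lra.
have := ltAB mu mu_inv.
rewrite (invm_fin mu_inv (borel_closed clA)) (invm_fin mu_inv (borel_open oB)).
rewrite -EFinD lte_fin -/(m A) -/(m B) => lt.
pose d := (m B - m A - c) / 4; have d0 : 0 < d by rewrite /d; lra.
have [n [[An_le Bn_le] nd]] := filter_ex (filterI (filterI
  (invm_closure_thicken mu_inv clA d0) (invm_closure_thicken mu_inv clCB d0))
  (near_infty_natSinv_lt (PosNum d0))).
move: An_le Bn_le (step n); rewrite (invmC mu_inv); last exact: borel_open.
by move: nd; rewrite /= -/(e n) -/(An n) -/(Bn n) -/(m _) -/(m _) -/(m _) -/(m _) /d; lra.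
Qed.

End Gap.

(** * Subequivalence, castles and comparison *)

Lemma fset_injection (S T : choiceType) (t0 : T) (E : {fset S}) (B : {fset T}) :
  (#|` E| <= #|` B|)%N ->
  exists f : S -> T, {in E &, injective f} /\ {in E, forall s, f s \in B}.
Proof.
move=> EB; exists (fun s => nth t0 B (index s E)); split => [s t sE tE|s sE].
  move=> /eqP; rewrite nth_uniq ?fset_uniq ?(leq_trans _ EB) ?index_mem//.
  by move=> /eqP st; rewrite -(nth_index s sE) st nth_index.
by apply: mem_nth; rewrite (leq_trans _ EB) ?index_mem.
Qed.

Section Subequivalence.
Context {R : realType} {G : groupType} {X : metricType R}.
Variable a : continuous_action G X.
Implicit Types (g h : G) (A B C U V : set X) (F K S : {fset G}).

(** Coincidences in an indexed family do no harm: a set that occurs with several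
    indices keeps the translation of one of them. *)
Lemma family_subequivalent (J : choiceType) (D : set J) (U : J -> set X)
    (s : J -> G) A B : finite_set D -> (forall j, D j -> open (U j)) ->
  A `<=` \bigcup_(j in D) U j -> trivIset D (fun j => a (s j) @` U j) ->
  (forall j, D j -> a (s j) @` U j `<=` B) -> subequivalent a 0 A B.
Proof.
move=> finD oU AU tU UB C _ CA.
pose UU := U @` D.
have /choice[r rP] V : exists g, UU V -> exists j, [/\ D j, U j = V & g = s j].
  have [[j Dj <-]|nV] := pselect (UU V); last by exists 1%g.
  by exists (s j) => _; exists j.
exists UU, r, (fun=> ord0); split.
- exact: finite_image.
- by move=> _ [j Dj <-]; exact: oU.
- by move=> x /CA/AU[j Dj Ux]; exists (U j) => //; exists j.
- move=> i; split => [V W [/rP[j [Dj <- ->]] _] [/rP[k [Dk <- ->]] _]|V].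
    by move=> jk; rewrite (tU _ _ Dj Dk jk).
  by move=> [/rP[j [Dj <- ->]] _]; exact: UB.
Qed.

(** Pieces that have been moved into disjoint sets [L l] can be moved on along
    an injection of the indices; pieces of different colours may overlap
    before, and no longer do afterwards. *)
Lemma rearrange (J T Col : choiceType) (D : set J) (U : J -> set X)
    (s : J -> G) (c : J -> Col) (E : set T) (L : T -> set X)
    (Ec : Col -> set T) (t : Col -> T -> T) (h : Col -> T -> G) A B :
  finite_set D -> finite_set E -> trivIset E L ->
  (forall j, D j -> open (U j)) -> (forall l, E l -> open (L l)) ->
  A `<=` \bigcup_(j in D) U j ->
  (forall i j, D i -> D j -> c i = c j ->
     a (s i) @` U i `&` a (s j) @` U j !=set0 -> i = j) ->
  (forall j, D j -> a (s j) @` U j `<=` \bigcup_(l in Ec (c j)) L l) ->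
  (forall k l, Ec k l -> [/\ E l, E (t k l), a (h k l) @` L l `<=` L (t k l)
                           & L (t k l) `<=` B]) ->
  (forall k l k' l', Ec k l -> Ec k' l' -> t k l = t k' l' -> k = k' /\ l = l') ->
  subequivalent a 0 A B.
Proof.
move=> finD finE tL oU oL AU sU UL hL t_inj.
pose D' : set (J * T) := [set p | D p.1 /\ Ec (c p.1) p.2].
pose U' (p : J * T) := U p.1 `&` a (s p.1)^-1%g @` L p.2.
pose s' (p : J * T) := (h (c p.1) p.2 * s p.1)%g.
have s'U p : a (s' p) @` U' p =
    a (h (c p.1) p.2) @` (a (s p.1) @` U p.1 `&` L p.2).
  by rewrite act_imageM /U' act_imageI -act_imageM mulgV act_image1.
have s'L p : D' p -> a (s' p) @` U' p `<=` L (t (c p.1) p.2).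
  move=> [_ /hL[_ _ hLt _]]; rewrite s'U; apply: subset_trans hLt.
  by apply: image_subset => x [].
apply: (@family_subequivalent _ D' U' s').
- apply: sub_finite_set (finite_setX finD finE) => -[j l] [/= Dj /hL[]].
  by split.
- move=> [j l] [/= Dj /hL[El _ _ _]]; apply: openI; first exact: oU.
  by apply: act_open; exact: oL.
- move=> x /AU[j Dj Ujx].
  have /(UL j Dj)[l El Lx] : (a (s j) @` U j) (a (s j) x) by exists x.
  by exists (j, l) => //; split => //; apply/act_imageE; rewrite invgK.
- move=> [i l] [j k] Di Dj [x [xi xj]].
  have [[Dj1 Ej] [Di1 Ei]] := (Dj, Di).
  have [_ Etj _ _] := hL _ _ Ej; have [_ Eti _ _] := hL _ _ Ei.
  have [cij lk] : c i = c j /\ l = k.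
    apply: (t_inj _ _ _ _ Ei Ej); apply: (tL _ _ Eti Etj).
    by exists x; split; [exact: (s'L (i, l))|exact: (s'L (j, k))].
  move: xi xj; rewrite !s'U /= -cij -lk => -[y [yi _] <-] [z [zj _]].
  move=> /(can_inj (actK _ _)) zy; rewrite zy in zj.
  by congr (_, _) => //; apply: sU => //; exists y.
- move=> [j l] Dj; apply: subset_trans (s'L _ Dj) _.
  by have [_ /hL[]] := Dj.
Qed.

Lemma act_diameter A (d : R) x y : (diameter A < d%:E)%E -> A x -> A y ->
  mdist x y < d.
Proof.
move=> Ad Ax Ay; rewrite -lte_fin; apply: le_lt_trans Ad.
by apply: ereal_sup_ubound; exists x => //; exists y.
Qed.

Section Castle.
Context {I : finType}.
Variables (V : I -> set X) (S : I -> {fset G}).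

Definition level (p : I * G) : set X := a p.2 @` V p.1.

Definition in_castle : set (I * G) := [set p | p.2 \in S p.1].

Lemma finite_in_castle : finite_set in_castle.
Proof.
have -> : in_castle = [set: I] `*`` (fun i => [set` S i]).
  by apply/seteqP; split => -[i s]//= [].
by apply: finite_setXR => [|i _]; [exact: finite_finset|exact: finite_fset].
Qed.

Lemma level_trivIset : is_castle a V S -> trivIset in_castle level.
Proof.
move=> [tower tS] [i s] [j t] /= si tj [x [xi xj]].
have ij : i = j.
  by apply: tS => //; exists x; split; [exists s|exists t].
rewrite -{}ij in tj xj *; congr (_, _).
by apply: (tower i) => //; exists x.
Qed.

Lemma castle_supportE : \bigcup_i tower_support a (V i) (S i) =
  \bigcup_(p in in_castle) level p.
Proof.
apply/seteqP; split => [x [i _ [s /= sS sVx]]|x [[i s] /= sS sVx]].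
  by exists (i, s).
by exists i => //; exists s.
Qed.

Lemma castle_remainder_closed : (forall i, open (V i)) ->
  closed (~` \bigcup_i tower_support a (V i) (S i)).
Proof.
move=> oV; apply: open_closedC; rewrite castle_supportE.
by apply: bigcup_open => p _; exact: act_open.
Qed.

End Castle.

Hypothesis X_compact : compact [set: X].

(** In each tower the levels that meet [C] are outnumbered, by a definite
    proportion, by the levels contained in [B], so that the former can be moved
    onto some of the latter, leaving room for the remainder of the castle. *)
Lemma almost_finite_comparison : almost_finite a -> has_comparison R a 0.
Proof.
move=> af A B oA oB _ _ ltAB C clC CA.
have ltCB (mu : set X -> \bar R) : invariant_measures a mu -> (mu C + 0%:E < mu B)%E.
  move=> mu_inv; rewrite adde0; apply: (le_lt_trans _ (ltAB mu mu_inv)).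
  have bC := borel_closed clC; have bA := borel_open oA.
  by rewrite (invm_fin mu_inv bC) (invm_fin mu_inv bA) lee_fin (invm_le mu_inv).
have [e [K [e0 gap]]] := uniform_gap X_compact clC oB ltCB.
pose n := (Num.trunc e^-1).+1.
have n_gt : e^-1 < n%:R by exact: truncnS_gt.
have [] := af n (1%g |` K)%fset e isT _ e0.
  by apply/fset0Pn; exists 1%g; rewrite !inE eqxx.
move=> I [V [S [S' [[castle oV] Sinv diam S'S]]]].
move=> /(_ _ (castle_remainder_closed oV) (fun x Rx => Rx)).
move=> [UU [s [c [finUU oUU coverUU transUU]]]].
pose SC i := [fset g in S i | `[< (a g @` V i `&` C !=set0)%classic >]]%fset.
pose SB i := [fset g in S i | `[< (a g @` V i `<=` B)%classic >]]%fset.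
(* The levels of tower [i] that need a place in [B]: [false] marks those that
   receive the remainder of the castle, [true] those that meet [C]. *)
pose Ei i := ([fset (false, g) | g in S' i] `|` [fset (true, g) | g in SC i])%fset.
have card_le i : V i !=set0 -> (#|` Ei i| <= #|` SB i|)%N.
  move=> [v Vv].
  have S0 : S i != fset0.
    apply/eqP => S0; have := (S'S i).2; rewrite S0 cardfs0 mul0r.
    by rewrite ltNge ler0n.
  have SK g : g \in K ->
      #|` mulfs [fset g]%fset (S i) `\` S i|%fset%:R <= e * #|` S i|%:R.
    move=> gK; apply: le_trans (ltW (Sinv i)); rewrite ler_nat.
    apply: fsubset_leq_card; apply/fsubsetP => x; rewrite !inE => /andP[-> /=].
    move=> /mulfsP[_ /fset1P-> [f fS ->]]; apply/orP; left.
    by apply/(mulfsP (1%g |` K)%fset); exists g; rewrite ?inE ?gK ?orbT//; exists f.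
  have := gap (S i) S0 SK v; rewrite addr0 /emp.
  set nC := #|` visits _ _ _ (thicken _ C)|; set nB := #|` visits _ _ _ _|.
  have S_gt0 : 0 < #|` S i|%:R :> R by rewrite ltr0n cardfs_gt0.
  rewrite -(ler_pM2r S_gt0) mulrDl !divfK ?gt_eqF// => gapi.
  have S'e : #|` S' i|%:R <= e * #|` S i|%:R.
    apply: le_trans (ltW (S'S i).2) _; rewrite mulrC ler_wpM2r//.
    by rewrite -[e]invrK lef_pV2 ?posrE ?invr_gt0 ?ltr0n// ltW.
  have SCn : (#|` SC i| <= nC)%N.
    apply: fsubset_leq_card; apply/fsubsetP => g; rewrite !inE => /andP[gS /asboolP].
    move=> [_ [[y Vy <-] Cy]]; rewrite gS; apply/asboolP; exists (a g y) => //.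
    by apply: (act_diameter (diam i g gS)); [exists y|exists v].
  have SBn : (nB <= #|` SB i|)%N.
    apply: fsubset_leq_card; apply/fsubsetP => g; rewrite !inE => /andP[gS /asboolP nb].
    rewrite gS; apply/asboolP => _ [y Vy <-]; apply: contrapT => nBy; apply: nb.
    by exists (a g y) => //; apply: (act_diameter (diam i g gS)); [exists y|exists v].
  apply: (@leq_trans (#|` S' i| + #|` SC i|)%N).
    apply: (@leq_trans (#|` [fset (false, g) | g in S' i]%fset|
                        + #|` [fset (true, g) | g in SC i]%fset|)%N).
      by rewrite -cardfsUI leq_addr.
    by apply: leq_add; exact: leq_imfset_card.
  apply: leq_trans SBn; rewrite -(ler_nat R) natrD.
  have : #|` SC i|%:R <= nC%:R :> R by rewrite ler_nat.
  by move: S'e gapi; lra.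
have /choice[f fP] i : exists f : bool * G -> G, V i !=set0 ->
    {in Ei i &, injective f} /\ {in Ei i, forall p, f p \in SB i}.
  have [/card_le/(fset_injection 1%g)[f fP]|nV] := pselect (V i !=set0).
    by exists f.
  by exists snd.
pose Ec (b : bool) : set (I * G) := [set p | V p.1 !=set0 /\ (b, p.2) \in Ei p.1].
have inS' i g : g \in S' i -> (false, g) \in Ei i.
  by move=> gS; rewrite inE; apply/orP; left; apply/imfsetP; exists g.
have inSC i g : g \in SC i -> (true, g) \in Ei i.
  by move=> gS; rewrite inE; apply/orP; right; apply/imfsetP; exists g.
have EiS b i g : (b, g) \in Ei i -> g \in S i.
  rewrite inE => /orP[] /imfsetP[h /= hS [_ ->]].
    by apply: (fsubsetP (S'S i).1).
  by move: hS; rewrite !inE => /andP[].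
pose D (j : set X + I * G) : Prop :=
  match j with inl U => UU U | inr p => p.2 \in SC p.1 end.
pose Uj (j : set X + I * G) : set X :=
  match j with inl U => U | inr p => level V p end.
pose sj (j : set X + I * G) : G := match j with inl U => s U | inr p => 1%g end.
pose cj (j : set X + I * G) : bool := if j is inl _ then false else true.
apply: (@rearrange _ _ _ D Uj sj cj (in_castle S) (level V) Ec
  (fun b p => (p.1, f p.1 (b, p.2))) (fun b p => (f p.1 (b, p.2) * p.2^-1)%g)
  C B) clC (fun x Cx => Cx).
- have finSC : finite_set [set p : I * G | p.2 \in SC p.1].
    apply: sub_finite_set (finite_in_castle S) => p.
    by rewrite /= !inE => /andP[].
  have finU := finite_image (@inl _ (I * G)) finUU.
  have finp := finite_image (@inr (set X) _) finSC.
  have finUp := conj finU finp; rewrite -finite_setU in finUp.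
  apply: sub_finite_set finUp => -[U|p] /= H; first by left; exists U.
  by right; exists p.
- exact: finite_in_castle.
- exact: level_trivIset.
- by case=> [U /oUU//|p _]; exact: act_open.
- by move=> p _; exact: act_open.
- move=> x Cx; have [|/coverUU[U UUU Ux]] := pselect
      ((\bigcup_i tower_support a (V i) (S i)) x); last by exists (inl U).
  rewrite castle_supportE => -[p pS px]; exists (inr p) => //=.
  by rewrite !inE pS; apply/asboolP; exists x.
- move=> [U|p] [U'|p'] //= UU1 UU2 _.
    move=> H; congr inl; apply: (transUU ord0).1 => //; split => //=;
    by apply: val_inj; case: (c _) => -[|k].
  rewrite !act_image1 => H; congr inr; apply: (level_trivIset castle) H.
    by move: UU1; rewrite !inE => /andP[].
  by move: UU2; rewrite !inE => /andP[].
- move=> [U|p] /= UU1.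
    have cU : c U = ord0 by apply: val_inj; case: (c _) => -[|k].
    move=> x /((transUU ord0).2 U (conj UU1 cU))[i _ [g /= gS' gx]].
    exists (i, g) => //; split; last exact: inS'.
    by have [y Vy _] := gx; exists y.
  rewrite act_image1 => x px; exists p => //; split; last exact: inSC.
  by have [y Vy _] := px; exists y.
- move=> b p [Vp0 Ep]; have [_ /(_ _ Ep)] := fP _ Vp0.
  rewrite !inE => /andP[fS /asboolP fB]; split => //; first exact: EiS Ep.
  by rewrite /level/= -act_imageM mulgVK.
- move=> b p b' p' [Vp Ep] [Vp' Ep'] [p1]; rewrite -p1 in Ep' *.
  have [inj _] := fP _ Vp => /(inj _ _ Ep Ep')[-> p2]; split => //.
  by case: p p' p1 p2 {Vp Vp' Ep Ep' inj} => i g [i' g'] /= -> ->.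
Qed.

End Subequivalence.

(** * Almost finiteness gives small boundaries *)

Section CastleMass.
Context {R : realType} {G : groupType} {X : metricType R}.
Variable a : continuous_action G X.
Implicit Types (g h : G) (A B C U V : set X) (F K S : {fset G}).

Lemma sub_castle (I : finType) (V : I -> set X) (S S' : I -> {fset G}) :
  is_castle a V S -> (forall i, (S' i `<=` S i)%fset) -> is_castle a V S'.
Proof.
move=> [tow tS] S'S; split => [i s t /(fsubsetP (S'S i)) si /(fsubsetP (S'S i)) ti|].
  exact: tow.
move=> i j _ _ [x [[s /(fsubsetP (S'S i)) si xs] [t /(fsubsetP (S'S j)) tj xt]]].
by apply: tS => //; exists x; split; [exists s|exists t].
Qed.

Lemma tower_support_borel V S : borel V -> borel (tower_support a V S).
Proof. by move=> bV; apply: borel_bigcup_seq => s; exact: borel_act. Qed.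

Lemma castle_support_borel (I : finType) (V : I -> set X) (S : I -> {fset G}) :
  (forall i, borel (V i)) -> borel (\bigcup_i tower_support a (V i) (S i)).
Proof.
move=> bV; have -> : [set: I] = [set` index_enum I].
  by apply/seteqP; split => // i _ /=; rewrite mem_index_enum.
by apply: borel_bigcup_seq => i; exact: tower_support_borel.
Qed.

Lemma castle_mass (mu : set X -> \bar R) (I : finType) (V : I -> set X)
    (S : I -> {fset G}) : invariant_measures a mu -> is_castle a V S ->
  (forall i, borel (V i)) ->
  fine (mu (\bigcup_i tower_support a (V i) (S i))) =
  \sum_i #|` S i|%:R * fine (mu (V i)).
Proof.
move=> mu_inv [tow tS] bV.
have IE : [set: I] = [set` index_enum I].
  by apply/seteqP; split => // i _ /=; rewrite mem_index_enum.
rewrite {1}IE (invm_bigcup mu_inv) ?index_enum_uniq//; last 2 first.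
- by move=> i; exact: tower_support_borel.
- by rewrite -IE.
apply: eq_bigr => i _; rewrite /tower_support (invm_bigcup mu_inv) ?fset_uniq//.
- under eq_bigr do rewrite (invm_act mu_inv _ (bV i)).
  by rewrite big_const_seq count_predT iter_addr_0 mulr_natl.
- by move=> s; exact: borel_act.
- exact: tow.
Qed.

(** A subequivalence bounds masses: the covering sets are carried to disjoint
    subsets of the target. *)
Lemma subequivalent_mass A B : subequivalent a 0 A B -> closed A -> borel B ->
  exists Z, [/\ open Z, A `<=` Z & forall mu : set X -> \bar R,
    invariant_measures a mu -> fine (mu Z) <= fine (mu B)].
Proof.
move=> AB clA bB; have [UU [s [c [finUU oUU AUU tUU]]]] := AB A clA (fun x Ax => Ax).
have /finite_fsetP[D UUD] := finUU.
exists (\bigcup_(U in UU) U); split => //; first exact: bigcup_open.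
move=> mu mu_inv.
have c0 U : c U = ord0 by apply: val_inj; case: (c U) => -[|k].
pose D1 := [seq U <- D | `[< open U >]].
pose F U := if `[< open U >] then U else set0.
have bF U : borel (F U).
  by rewrite /F; case: asboolP => oU; [exact: borel_open|exact: borel0].
have DUU U : U \in (D : seq _) -> UU U by rewrite UUD.
have FE U : UU U -> F U = U by move=> /oUU oU; rewrite /F asboolT.
have -> : \bigcup_(U in UU) U = \bigcup_(U in [set` (D : seq _)]) F U.
  by rewrite UUD; apply: eq_bigcupr => U /DUU /FE.
apply: le_trans (invm_bigcup_le mu_inv _ bF) _.
under eq_bigr => U _ do rewrite -(invm_act mu_inv (s U) (bF U)).
have bsF U : borel (a (s U) @` F U) by exact: borel_act.
rewrite -(invm_bigcup mu_inv (fset_uniq D) bsF).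
  apply: (invm_le mu_inv) => //; first exact: borel_bigcup_seq.
  move=> x [U /DUU UUU]; rewrite FE// => Ux.
  by apply: ((tUU ord0).2 U) => //; split => //; exact: c0.
move=> U V /DUU UUU /DUU UUV; rewrite !FE//.
by apply: (tUU ord0).1; split => //; exact: c0.
Qed.

Hypothesis X_compact : compact [set: X].

(** The closed neighbourhoods of [C] decrease to [C], so that by compactness one
    of them is contained in [U]. *)
Lemma thicken_sub C U : closed C -> open U -> C `<=` U ->
  exists2 k : R, 0 < k & thicken k C `<=` U.
Proof.
move=> clC oU CU.
have cU : compact (~` U) by apply: subclosed_compact X_compact _ => //; exact: open_closedC.
pose F (n : nat) := ~` closure (thicken n.+1%:R^-1 C).
have oF n : open (F n) by apply: closed_openC; exact: closed_closure.
have [x nUx|D UD] := compact_finite_cover cU oF.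
  apply: contrapT => nF; apply: nUx; apply: CU; apply: closed_thicken => // n.
  by apply: contrapT => nx; apply: nF; exists n.
pose N := (\max_(i <- enum_fset D) i)%N.
exists (N.+1%:R^-1) => [|x Cx]; first by rewrite invr_gt0.
apply: contrapT => /UD[n /= nD]; apply; apply: subset_closure.
apply: (@thickenS _ _ N.+1%:R^-1); last exact: Cx.
by rewrite lef_pV2 ?posrE// ler_nat ltnS; exact: leq_bigmax_seq.
Qed.

Hypothesis a_af : almost_finite a.

(** The levels of a castle with small levels are almost without boundary: the
    boundary of a union of levels lies in the remainder of the castle, which
    has a neighbourhood of small mass.  The levels that meet [C], with a small
    neighbourhood of the part of [C] in the remainder, form [W]. *)
Lemma small_collar C U (e : R) : closed C -> open U -> C `<=` U -> 0 < e ->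
  exists W Z, [/\ open W, open Z, C `<=` W, closure W `<=` Z /\ closure Z `<=` U
    & forall mu : set X -> \bar R, invariant_measures a mu ->
        fine (mu (Z `\` W)) <= e].
Proof.
move=> clC oU CU e0.
have [U' [oU' CU' U'U]] := normal_between clC oU CU.
have [k k0 kU'] := thicken_sub clC oU' CU'.
pose n := (Num.trunc e^-1).+1.
have n_gt : e^-1 < n%:R by exact: truncnS_gt.
have [] := a_af (n := n) (K := [fset 1%g]%fset) isT _ k0.
  by apply/fset0Pn; exists 1%g; rewrite inE.
move=> I [V [S [S' [[castle oV] _ diam S'S sub]]]].
have bV i : borel (V i) by exact: borel_open.
have clR := castle_remainder_closed (a := a) (S := S) oV.
have bB := castle_support_borel S' bV.
have [Z [oO RO massO]] := subequivalent_mass sub clR bB.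
have massOe mu : invariant_measures a mu -> fine (mu Z) <= e.
  move=> mu_inv; apply: le_trans (massO mu mu_inv) _.
  have cS' : is_castle a V S' by apply: sub_castle castle (fun i => (S'S i).1).
  rewrite (castle_mass mu_inv cS' bV).
  have := invm_le1 mu_inv (castle_support_borel S bV).
  rewrite (castle_mass mu_inv castle bV) => mass1.
  have en : n%:R^-1 <= e.
    by rewrite -[e]invrK lef_pV2 ?posrE ?invr_gt0 ?ltr0n// ltW.
  apply: (@le_trans _ _ (\sum_i (#|` S i|%:R / n%:R) * fine (mu (V i)))).
    apply: ler_sum => i _; apply: ler_wpM2r; first exact: (invm_ge0 mu_inv).
    exact: ltW (S'S i).2.
  under eq_bigr do rewrite mulrAC.
  rewrite -mulr_suml; apply: le_trans en; rewrite -[leRHS]mul1r.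
  by rewrite ler_wpM2r// invr_ge0.
set Rm := ~` _ in clR RO.
have oOU : open (Z `&` U') by exact: openI.
have RCO : Rm `&` C `<=` Z `&` U' by move=> x [/RO Ox /CU'].
have [N [oN RN NO]] := normal_between (closedI clR clC) oOU RCO.
pose meets := [set p | in_castle S p /\ level a V p `&` C !=set0].
pose W := (\bigcup_(p in meets) level a V p) `|` N.
have oL p : open (level a V p) by exact: act_open.
have oW : open W by apply: openU => //; exact: bigcup_open.
have CW : C `<=` W.
  move=> x Cx; have [Rx|] := pselect (Rm x); first by right; exact: RN.
  move=> /contrapT; rewrite castle_supportE => -[p pS px]; left.
  by exists p => //; split => //; exists x.
have WU' : W `<=` U'.
  move=> x [[p [pS [y [py Cy]]] px]|/(@subset_closure _ N)/NO[]//]; apply: kU'.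
  by exists y => //; exact: act_diameter (diam _ _ pS) py px.
have clWO : closure W `<=` (W `|` Z) `&` U.
  move=> x clWx; split; last exact: U'U (closureS WU' _).
  have [Ox|nOx] := pselect (Z x); first by right.
  have : ~ Rm x by move=> /RO.
  move=> /contrapT; rewrite castle_supportE => -[p pS px].
  have nNx : (~` closure N) x by move=> /NO[].
  have oLN : open (level a V p `&` ~` closure N).
    by apply: openI => //; apply: closed_openC; exact: closed_closure.
  have [y [Wy [py nNy]]] := clWx _ (open_nbhs_nbhs (conj oLN (conj px nNx))).
  have [[q [qS qC] qy]|/(@subset_closure _ N)//] := Wy.
  left; left; exists p => //; split => //.
  by rewrite (level_trivIset castle pS qS)//; exists y.
have oWOU : open ((W `|` Z) `&` U) by apply: openI => //; exact: openU.
have [Q [oQ WQ QWO]] := normal_between (@closed_closure _ W) oWOU clWO.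
exists W, Q; split => //; first by split => // x /QWO[].
move=> mu mu_inv; apply: le_trans (massOe mu mu_inv).
apply: (invm_le mu_inv); [|exact: borel_open|].
  by apply: borelD; exact: borel_open.
by move=> x [/(@subset_closure _ Q)/QWO[[]]].
Qed.

(** Iterating [small_collar] between the closure of the last [W] and the last
    [Z]: the union of the [W]'s lies in every [Z], with its closure, so that its
    boundary lies in every [Z `\` W]. *)
Lemma null_boundary_between C U : closed C -> open U -> C `<=` U ->
  exists W, [/\ open W, C `<=` W, W `<=` U & forall mu : set X -> \bar R,
    invariant_measures a mu -> mu (boundary W) = 0%E].
Proof.
move=> clC oU CU.
pose good (p : set X * set X) := [/\ open p.1, open p.2 & closure p.1 `<=` p.2].
pose refines (n : nat) (p q : set X * set X) :=
  [/\ good q, p.1 `<=` q.1, closure q.2 `<=` p.2 &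
    forall mu : set X -> \bar R, invariant_measures a mu ->
      fine (mu (q.2 `\` q.1)) <= n.+1%:R^-1].
have /choice[f fP] (np : nat * (set X * set X)) :
    exists q, good np.2 -> refines np.1 np.2 q.
  have [[oW oO WO]|ng] := pselect (good np.2); last by exists np.2.
  have pos : 0 < np.1.+1%:R^-1 :> R by rewrite invr_gt0 ltr0n.
  have [W [Z [oW' oO' WW' [WO' Z'Z] mass]]] :=
    small_collar (@closed_closure _ np.2.1) oO WO pos.
  exists (W, Z) => _; split => //; exact: subset_trans (@subset_closure _ _) WW'.
have [W0 [oW0 CW0 W0U]] := normal_between clC oU CU.
pose p := fix p n := if n is k.+1 then f (k, p k) else (W0, U).
have goodp n : good (p n).
  by elim: n => [|n IH]; first (by split); have [] := fP (n, p n) IH.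
have step n : refines n (p n) (p n.+1) by exact: (fP (n, p n) (goodp n)).
have incW n k : (n <= k)%N -> (p n).1 `<=` (p k).1.
  elim: k => [|k IH]; first by rewrite leqn0 => /eqP->.
  rewrite leq_eqVlt => /orP[/eqP->//|/IH nk]; apply: subset_trans nk _.
  by have [] := step k.
have decO n k : (n <= k)%N -> (p k).2 `<=` (p n).2.
  elim: k => [|k IH]; first by rewrite leqn0 => /eqP->.
  rewrite leq_eqVlt => /orP[/eqP->//|/IH nk]; apply: subset_trans nk.
  have [_ _ + _] := step k; apply: subset_trans; exact: subset_closure.
pose W := \bigcup_n (p n).1.
have WO n : W `<=` (p n).2.
  have sub k : (p k).1 `<=` (p k).2.
    by have [_ _] := goodp k; apply: subset_trans; exact: subset_closure.
  move=> x [k _ kx]; have [nk|kn] := leqP n k; first exact: decO nk _ (sub k _ kx).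
  exact: sub n _ (incW _ _ (ltnW kn) _ kx).
have oW : open W by apply: bigcup_open => n _; case: (goodp n).
have bdW n : boundary W `<=` (p n.+1).2 `\` (p n.+1).1.
  move=> x [clx nWx]; split.
    have [_ _ + _] := step n.+1; apply; exact: closureS (WO n.+2) _ clx.
  move=> px; apply: nWx; apply: open_nbhs_nbhs; split => //.
  by exists n.+1.
exists W; split => //.
- by move=> x /CW0 W0x; exists 0%N.
- exact: WO 0%N.
move=> mu mu_inv.
have bbd : borel (boundary W).
  apply: borelD; first by apply: borel_closed; exact: closed_closure.
  by apply: borel_open; exact: open_interior.
rewrite (invm_fin mu_inv bbd); congr _%:E; apply/eqP.
rewrite eq_le (invm_ge0 mu_inv) andbT; apply/ler_addgt0Pr => e e0; rewrite add0r.
have [n _ /(_ n (leqnn n)) /= ne] := near_infty_natSinv_lt (PosNum e0).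
apply: le_trans _ (ltW ne); have [_ _ _ mass] := step n.
apply: le_trans (mass mu mu_inv); apply: (invm_le mu_inv) => //.
by have [ op1 op2 _] := goodp n.+1; apply: borelD; exact: borel_open.
Qed.

Lemma almost_finite_small_boundary : small_boundary_property R a.
Proof.
exists [set W | open W /\ forall mu : set X -> \bar R,
  invariant_measures a mu -> mu (boundary W) = 0%E]; last by move=> U [].
split=> [U []//|x N]; rewrite nbhsE => -[U [oU Ux] UN].
have cl1 : closed [set x].
  exact: accessible_closed_set1 (hausdorff_accessible (@metric_hausdorff R X)) x.
have xU : [set x] `<=` U by move=> _ ->.
have [W [oW xW WU nullW]] := null_boundary_between cl1 oU xU.
exists W; last exact: subset_trans WU UN.
by split; [split|exact: xW].
Qed.

End CastleMass.

(** * Sets with null boundary and quasi-tilings *)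

Section Tame.
Context {R : realType} {G : groupType} {X : metricType R}.
Variable a : continuous_action G X.
Implicit Types (g h : G) (A B C U V : set X) (F K S : {fset G}).

(** An invariant algebra of Borel sets that are clopen up to null sets. *)
Definition tame A := borel A /\ forall mu : set X -> \bar R,
  invariant_measures a mu -> fine (mu (boundary A)) = 0.

Lemma boundary_closed A : closed (boundary A).
Proof.
by apply: closedI; [exact: closed_closure|apply: open_closedC; exact: open_interior].
Qed.

Lemma null_subset (mu : set X -> \bar R) A B : invariant_measures a mu ->
  borel A -> borel B -> A `<=` B -> fine (mu B) = 0 -> fine (mu A) = 0.
Proof.
move=> mu_inv bA bB AB B0; apply/eqP; rewrite eq_le (invm_ge0 mu_inv) andbT -B0.
exact: (invm_le mu_inv).
Qed.

Lemma tame0 : tame set0.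
Proof.
split=> [|mu mu_inv]; first exact: borel0.
by rewrite /boundary closure0 set0D (invm0 mu_inv).
Qed.

Lemma tameC A : tame A -> tame (~` A).
Proof.
move=> [bA nA]; split=> [|mu /nA <-]; first exact: borelC.
by rewrite /boundary !setDE interiorC closure_setC setCK setIC.
Qed.

Lemma tameU A B : tame A -> tame B -> tame (A `|` B).
Proof.
move=> [bA nA] [bB nB]; split=> [|mu mu_inv]; first exact: borelU.
have bdA := borel_closed (@boundary_closed A).
have bdB := borel_closed (@boundary_closed B).
apply: (null_subset mu_inv (borel_closed (@boundary_closed _)) (borelU bdA bdB)).
  move=> x [+ nx]; rewrite closureU => -[clx|clx]; [left|right]; split=> // ix.
    by apply: nx; apply: interiorS ix; exact: subsetUl.
  by apply: nx; apply: interiorS ix; exact: subsetUr.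
apply/eqP; rewrite eq_le (invm_ge0 mu_inv) andbT.
by apply: le_trans (invmUle mu_inv bdA bdB) _; rewrite nA// nB// addr0.
Qed.

Lemma tameI A B : tame A -> tame B -> tame (A `&` B).
Proof.
by move=> tA tB; rewrite -[A `&` B]setCK setCI; apply: tameC; apply: tameU; exact: tameC.
Qed.

(** Continuity gives both halves: the preimage of the closure is closed, and the
    preimage of the interior is open. *)
Lemma tame_preimage g A : tame A -> tame (a g @^-1` A).
Proof.
move=> [bA nA]; split=> [|mu mu_inv]; first exact: borel_preimage.
have cg : continuous (a g) by exact: act_continuous.
have bdA := borel_closed (@boundary_closed A).
apply: (null_subset mu_inv (borel_closed (@boundary_closed _)) (borel_preimage a g bdA)).
  move=> x [clx nx]; split.
    suff : closure (a g @^-1` A) `<=` a g @^-1` closure A by apply.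
    have clp : closed (a g @^-1` closure A).
      by apply: closed_comp; [move=> y _; exact: cg|exact: closed_closure].
    rewrite [X in _ `<=` X](closure_id _).1//.
    by apply: closureS; apply: preimage_subset; exact: subset_closure.
  move=> ix; apply: nx; apply: (cg x).
  exact: ix.
by rewrite (invm_preimage mu_inv g bdA) nA.
Qed.

Lemma tame_act g A : tame A -> tame (a g @` A).
Proof. by rewrite act_image_preimage; exact: tame_preimage. Qed.

Lemma tame_bigcup_seq (I : choiceType) (s : seq I) (A : I -> set X) :
  (forall i, tame (A i)) -> tame (\bigcup_(i in [set` s]) A i).
Proof.
by move=> tA; rewrite bigcup_seq; apply: big_ind => //; [exact: tame0|exact: tameU].
Qed.

Lemma tame_bigcap_seq (I : choiceType) (s : seq I) (A : I -> set X) :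
  (forall i, tame (A i)) -> tame (\bigcap_(i in [set` s]) A i).
Proof.
move=> tA; rewrite -[X in tame X]setCK setC_bigcap; apply: tameC.
by apply: tame_bigcup_seq => i; exact: tameC.
Qed.

End Tame.

Section QuasiTiling.
Context {R : realType} {G : groupType} {X : metricType R}.
Variable a : continuous_action G X.
Variable eps : R.
Implicit Types (g h : G) (A B C U V Y : set X) (F K S : {fset G}).
Implicit Types (L : seq (set X * {fset G})).

Definition ample F S := (1 - eps) * #|` F|%:R <= #|` S|%:R.

Definition cell Y U F S : set X := [set x | U x /\ visits a F x (~` Y) = S].

Definition centers Y U F : set X := [set x | U x /\ ample F (visits a F x (~` Y))].

(** The greedy process: the entries [(U, F)] are treated from the last to the
    first; a point [x] of [U] becomes the centre of a tile [F x] if most of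
    [F x] is not yet covered. *)
Fixpoint covered L : set X :=
  if L is (U, F) :: L' then
    covered L' `|` tower_support a (centers (covered L') U F) F
  else set0.

Definition ample_subsets F := [seq S <- enum_fset (fpowerset F) | `[< ample F S >]].

Lemma ample_subsetsP F S :
  reflect ((S `<=` F)%fset /\ ample F S) (S \in ample_subsets F).
Proof.
rewrite mem_filter fpowersetE.
by apply: (iffP andP) => -[H1 H2]; split => //; exact/asboolP.
Qed.

Lemma centersE Y U F :
  centers Y U F = \bigcup_(S in [set` ample_subsets F]) cell Y U F S.
Proof.
apply/seteqP; split => [x [Ux aS]|x [S /= /ample_subsetsP[_ aS] [Ux vS]]]; last first.
  by split => //; rewrite vS.
exists (visits a F x (~` Y)) => //=; apply/ample_subsetsP; split => //.
exact: visits_sub.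
Qed.

(** For given shape [S], a cell is a finite Boolean combination of [U] and
    translates of [Y]. *)
Lemma tame_cell Y U F S : tame a Y -> tame a U -> tame a (cell Y U F S).
Proof.
move=> tY tU; pose E s := if s \in S then ~` (a s @^-1` Y) else a s @^-1` Y.
have tE s : tame a (E s).
  by rewrite /E; case: ifP => _; [apply: tameC|]; exact: tame_preimage.
have [SF|nSF] := boolP (S `<=` F)%fset; last first.
  rewrite (_ : cell _ _ _ _ = set0); first exact: tame0.
  by rewrite -subset0 => x [_ vS]; move: nSF; rewrite -vS visits_sub.
rewrite (_ : cell _ _ _ _ = U `&` \bigcap_(s in [set` enum_fset F]) E s).
  by apply: tameI => //; exact: tame_bigcap_seq.
apply/seteqP; split => x [Ux].
  move=> vS; split => // s /= sF; rewrite /E -vS in_visits sF /=.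
  by case: asboolP => //= /contrapT.
move=> EF; split => //; apply/fsetP => s; rewrite in_visits.
have [sF|sF] /= := boolP (s \in F); last first.
  by apply/esym/negbTE; apply: contra sF => /(fsubsetP SF).
have := EF s sF; rewrite /E; case: ifP => _ H; first exact/asboolP.
by apply/asboolP => nH; exact: nH H.
Qed.

Lemma tame_centers Y U F : tame a Y -> tame a U -> tame a (centers Y U F).
Proof.
by move=> tY tU; rewrite centersE; apply: tame_bigcup_seq => S; exact: tame_cell.
Qed.

Definition tame_towers (d : R) (Q : {fset G} -> Prop) (p : set X * {fset G}) :=
  [/\ tame a p.1, is_tower a p.1 p.2,
      forall s, s \in p.2 -> (diameter (a s @` p.1) < d%:E)%E &
      forall S, (S `<=` p.2)%fset -> ample p.2 S -> Q S].

Lemma tame_covered L : (forall p, p \in L -> tame a p.1) -> tame a (covered L).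
Proof.
elim: L => [_|[U F] L IH tL] /=; first exact: tame0.
have tY : tame a (covered L) by apply: IH => p pL; apply: tL; rewrite inE pL orbT.
apply: tameU => //; apply: tame_bigcup_seq => s; apply: tame_act.
by apply: tame_centers => //; apply: (tL (U, F)); rewrite inE eqxx.
Qed.

Lemma diameterS A B : A `<=` B -> (diameter A <= diameter B)%E.
Proof.
move=> AB; apply: ge_ereal_sup => _ [x Ax [y Ay <-]].
by apply: ereal_sup_ubound; exists x; [exact: AB|exists y; [exact: AB|]].
Qed.

(** Cutting from each tile what was covered before, and sorting the centres by
    the shape that remains, turns the quasi-tiling into a castle. *)
Lemma covered_castle (d : R) (Q : {fset G} -> Prop) L :
  (forall p, p \in L -> tame_towers d Q p) ->
  exists (I : finType) (V : I -> set X) (S : I -> {fset G}),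
    [/\ is_castle a V S, \bigcup_i tower_support a (V i) (S i) = covered L,
        forall i, tame a (V i), forall i, Q (S i)
      & forall i s, s \in S i -> (diameter (a s @` V i) < d%:E)%E].
Proof.
elim: L => [_|[U F] L IH tL].
  exists void, (fun=> set0), (fun=> fset0).
  split; [by split; case| |by case|by case|by case].
  by rewrite -subset0 => x [[]].
have [p pL|I [V [S [[tow tS] SY tV QS dV]]]] := IH.
  by apply: tL; rewrite inE pL orbT.
have [/= tU towU dU QU] : tame_towers d Q (U, F) by apply: tL; rewrite inE eqxx.
have tY : tame a (covered L).
  apply: tame_covered => p pL.
  by have [] : tame_towers d Q p by apply: tL; rewrite inE pL orbT.
set Y := covered L in SY tY *.
pose T := 'I_(size (ample_subsets F)).
pose sh (j : T) := nth fset0 (ample_subsets F) j.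
have shP j : (sh j `<=` F)%fset /\ ample F (sh j).
  by apply/ample_subsetsP; exact: mem_nth.
pose V' (i : I + T) := match i with inl i => V i | inr j => cell Y U F (sh j) end.
pose S' (i : I + T) := match i with inl i => S i | inr j => sh j end.
have suppY i : tower_support a (V i) (S i) `<=` Y by rewrite -SY => x xi; exists i.
have suppnY j x : tower_support a (cell Y U F (sh j)) (sh j) x -> ~ Y x.
  move=> [s /= + [y [Uy vy] <-]]; rewrite -vy in_visits => /andP[_ /asboolP]; exact.
exists (I + T)%type, V', S'; split.
- split=> [[i|j]|[i|j] [i'|j'] _ _] /=.
  + exact: tow.
  + move=> s t /= /(fsubsetP (shP j).1) sF /(fsubsetP (shP j).1) tF.
    move=> [x [[y [Uy _] yx] [z [Uz _] zx]]]; apply: (towU s t sF tF).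
    by exists x; split; [exists y|exists z].
  + by move=> H; congr inl; exact: tS.
  + by move=> [x [/suppY Yx /suppnY]].
  + by move=> [x [/suppnY nYx /suppY]].
  + move=> [x [[s /= ss [y [Uy vy] yx]] [t /= tt [z [Uz vz] zx]]]]; congr inr.
    have st : s = t.
      apply: (towU s t); [exact: (fsubsetP (shP j).1)|exact: (fsubsetP (shP j').1)|].
      by exists x; split; [exists y|exists z].
    have yz : y = z by apply: (can_inj (actK a s)); rewrite yx -zx st.
    apply/val_inj/eqP; rewrite -(nth_uniq fset0 (ltn_ord j) (ltn_ord j')).
      by rewrite -/(sh j) -/(sh j') -vy -vz yz.
    by rewrite filter_uniq// fset_uniq.
- apply/seteqP; split => [x [[i|j] _ /= xi]|x [|[s /= sF [y [Uy ay] yx]]]].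
  + by left; exact: suppY xi.
  + right; move: xi => [s /= /(fsubsetP (shP j).1) sF [y [Uy vy] yx]].
    exists s => //; exists y => //; split => //; rewrite vy; exact: (shP j).2.
  + by rewrite -/Y -SY => -[i _ xi]; exists (inl i).
  + have [Yx|nYx] := pselect (Y x).
      by move: Yx; rewrite -SY => -[i _ xi]; exists (inl i).
    have vF : visits a F y (~` Y) \in ample_subsets F.
      by apply/ample_subsetsP; split => //; exact: visits_sub.
    pose j : T := Ordinal (eq_ind_r is_true vF (index_mem _ _)).
    have shj : sh j = visits a F y (~` Y) by rewrite /sh nth_index.
    exists (inr j) => //=; exists s => /=.
      by rewrite shj in_visits sF /=; apply/asboolP; rewrite yx.
    by exists y => //; split => //; rewrite shj.
- by case=> [i|j] /=; [exact: tV|exact: tame_cell].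
- by case=> [i|j] /=; [exact: QS|have [jF aj] := shP j; exact: QU].
- case=> [i|j] s /=; first exact: dV.
  move=> /(fsubsetP (shP j).1)/dU; apply: le_lt_trans; apply: diameterS.
  by apply: image_subset => x [].
Qed.

End QuasiTiling.

(** * The mass of a quasi-tiling *)

Section TilingMass.
Context {R : realType} {G : groupType} {X : metricType R}.
Variable a : continuous_action G X.
Variable eps : R.
Hypothesis eps_gt0 : 0 < eps.
Hypothesis eps_lt1 : eps < 1.
Variable mu : set X -> \bar R.
Hypothesis mu_inv : invariant_measures a mu.
Local Notation m A := (fine (mu A)).
Implicit Types (g h : G) (A B C U V Y : set X) (F K S H : {fset G}).
Implicit Types (L : seq (set X * {fset G})).
Local Notation centers := (centers a eps).
Local Notation covered := (covered a eps).

Lemma sum_visits F x A :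
  \sum_(s <- F) (`[< (a s @^-1` A) x >] : nat)%:R = #|` visits a F x A|%:R :> R.
Proof. by rewrite card_visits natr_sum. Qed.

Lemma card_visitsC F x A :
  (#|` visits a F x A| + #|` visits a F x (~` A)| = #|` F|)%N.
Proof.
rewrite !card_visits -big_split /= -[RHS]sum1_size; apply: eq_bigr => s _.
by case: asboolP => H; case: asboolP => // nH; case: nH.
Qed.

(** Each new tile brings in at least the proportion [1 - eps] of its points. *)
Lemma centers_mass Y U F : tame a Y -> tame a U -> is_tower a U F ->
  (1 - eps) * #|` F|%:R * m (centers Y U F) <=
  m (Y `|` tower_support a (centers Y U F) F) - m Y.
Proof.
move=> tY tU tow; have [bY _] := tY; set C := centers Y U F.
have [bC _] : tame a C by exact: tame_centers.
have bS : borel (tower_support a C F) by exact: tower_support_borel.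
have bYS := borelU bY bS.
pose D s := C `&` a s @^-1` (~` Y).
have bD s : borel (D s) by apply: borelI => //; apply: borel_preimage; exact: borelC.
rewrite lerBrDl (invm_split mu_inv bYS bY) setUK lerD2l.
apply: (@le_trans _ _ (\sum_(s <- F) m (D s))).
  apply: (invm_count_ge mu_inv) => //.
  - by rewrite mulr_ge0// subr_ge0 ltW.
  - by move=> s; apply: borel_preimage; exact: borelC.
  - by move=> x [_ aF]; rewrite (sum_visits F x (~` Y)).
have bsD s : borel (a s @` D s) by exact: borel_act.
under eq_bigr => s _ do rewrite -(invm_act mu_inv s (bD s)).
rewrite -(invm_bigcup mu_inv (fset_uniq F) bsD); last first.
  move=> s t sF tF [x [[y [[Uy _] _] yx] [z [[Uz _] _] zx]]].
  by apply: (tow s t sF tF); exists x; split; [exists y|exists z].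
apply: (invm_le mu_inv); [exact: borel_bigcup_seq|exact: borelD|].
move=> x [s /= sF [y [Cy nYy] yx]]; split; last by rewrite -yx.
by right; exists s => //; exists y.
Qed.

Definition tame_entry (p : set X * {fset G}) := tame a p.1 /\ is_tower a p.1 p.2.

Lemma tame_covered_entry L : (forall p, p \in L -> tame_entry p) ->
  tame a (covered L).
Proof. by move=> tL; apply: tame_covered => p /tL[]. Qed.

(** A union of almost disjoint, almost [H]-invariant tiles is almost
    [H]-invariant. *)
Lemma covered_invariant L H (eta : R) : 0 <= eta ->
  (forall p, p \in L -> tame_entry p) ->
  (forall p, p \in L -> #|` mulfs H p.2 `\` p.2|%fset%:R <= eta * #|` p.2|%:R) ->
  (1 - eps) * m (tower_support a (covered L) H `\` covered L) <= eta * m (covered L).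
Proof.
move=> eta0; elim: L => [_ _|[U F] L IH tL HL] /=.
  rewrite (_ : tower_support _ _ _ `\` _ = set0).
    by rewrite (invm0 mu_inv) !mulr0.
  by rewrite -subset0 => x [[h _ []]].
have {}tL' p : p \in L -> tame_entry p by move=> pL; apply: tL; rewrite inE pL orbT.
have {}IH := IH tL' (fun p pL => HL p (mem_behead (s := (U, F) :: L) pL)).
have tY := tame_covered_entry tL'; set Y := covered L in IH tY *.
have [tU towU] : tame_entry (U, F) by apply: tL; rewrite inE eqxx.
have HF := HL (U, F) (mem_head _ _).
set C := centers Y U F; have [bC _] : tame a C by exact: tame_centers.
have [bY _] := tY; have mC := centers_mass tY tU towU; rewrite -/C in mC.
set Y' := Y `|` _ in mC *.
have bY' : borel Y' by apply: borelU => //; exact: tower_support_borel.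
have bHY : borel (tower_support a Y H) by exact: tower_support_borel.
pose HF' := (mulfs H F `\` F)%fset.
have bHC : borel (tower_support a C HF') by exact: tower_support_borel.
have sub : tower_support a Y' H `\` Y' `<=`
    (tower_support a Y H `\` Y) `|` tower_support a C HF'.
  move=> x [[h /= hH [y [Yy|[f /= fF [c Cc cy]]] yx]] nYx].
    by left; split; [exists h => //; exists y|move=> Yx; apply: nYx; left].
  right; exists (h * f)%g; last by exists c => //; rewrite actM cy.
  rewrite /= inE; apply/andP; split; last by apply/mulfsP; exists h => //; exists f.
  apply/negP => hfF; apply: nYx; right; exists (h * f)%g => //.
  by exists c => //; rewrite actM cy.
have bd : m (tower_support a Y' H `\` Y') <=
    m (tower_support a Y H `\` Y) + #|` HF'|%:R * m C.
  apply: le_trans (_ : m ((tower_support a Y H `\` Y) `|` tower_support a C HF') <= _).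
    apply: (invm_le mu_inv) => //; last by apply: borelU => //; exact: borelD.
    by apply: borelD => //; exact: tower_support_borel.
  apply: le_trans (invmUle mu_inv (borelD bHY bY) bHC) _; rewrite lerD2l.
  have bsC s : borel (a s @` C) by exact: borel_act.
  apply: le_trans (invm_bigcup_le mu_inv _ bsC) _.
  under eq_bigr do rewrite (invm_act mu_inv _ bC).
  by rewrite big_const_seq count_predT iter_addr_0 mulr_natl.
have e1 : 0 < 1 - eps by rewrite subr_gt0.
have mC0 : 0 <= m C by exact: (invm_ge0 mu_inv).
apply: le_trans (ler_wpM2l (ltW e1) bd) _; rewrite mulrDr.
have h1 : #|` HF'|%:R * m C <= eta * #|` F|%:R * m C by exact: ler_wpM2r.
have h2 := ler_wpM2l (ltW e1) h1.
have h3 := ler_wpM2l eta0 mC.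
move: h2 h3 IH; set u := #|` F|%:R; set v := m C.
by set w := m (_ `\` _); set y := m Y; set z := m Y'; set q := _ * v; nra.
Qed.

Definition pass (L : seq (set X * {fset G})) (Us : seq (set X)) F :=
  [seq (U, F) | U <- Us] ++ L.

Lemma covered_pass_sub L Us F : covered L `<=` covered (pass L Us F).
Proof. by elim: Us => //= U Us IH x /IH; left. Qed.

(** Maximality of the greedy process: a point of [U] either became a centre, and
    its whole tile is covered, or was refused because too much of its tile was
    covered already. *)
Lemma pass_visits L Us F x : (exists2 U, U \in Us & U x) ->
  eps * #|` F|%:R <= #|` visits a F x (covered (pass L Us F))|%:R.
Proof.
elim: Us => [[]//|U Us IH] xUs.
have [Ux|nUx] := pselect (U x); last first.
  have xUs' : exists2 U, U \in Us & U x.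
    case: xUs => V; rewrite inE => /orP[/eqP->//|VUs Vx]; by exists V.
  apply: le_trans (IH xUs') _; rewrite ler_nat; apply: fsubset_leq_card.
  by apply: visitsS => y; left.
rewrite /= -/(pass L Us F); set Y := covered (pass L Us F).
have [aF|naF] := pselect (ample eps F (visits a F x (~` Y))).
  rewrite (_ : visits _ _ _ _ = F); first by rewrite ler_piMl// ltW.
  apply/fsetP => s; rewrite in_visits; have [sF|//] := boolP (s \in F).
  by apply/asboolP; right; exists s => //; exists x.
apply: le_trans (_ : #|` visits a F x Y|%:R <= _); last first.
  by rewrite ler_nat; apply/fsubset_leq_card/visitsS => y; left.
move: naF => /negP; rewrite -ltNge -(card_visitsC F x Y) natrD.
by rewrite !(mulrDr, mulrBl, mul1r); lra.
Qed.

(** Averaging over [F] the visits to the covered set, from the points [x] of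
    which the tile [F x] was still free: these are all the uncovered points, up
    to a mass [beta]. *)
Lemma pass_mass L Us F (beta : R) : F != fset0 ->
  (forall p, p \in pass L Us F -> tame_entry p) ->
  (forall x, exists2 U, U \in Us & U x) ->
  let FV := [fset g^-1%g | g in F]%fset in
  m (tower_support a (covered L) FV `\` covered L) <= beta ->
  1 - m (covered (pass L Us F)) <= (1 - eps) * (1 - m (covered L)) + eps * beta.
Proof.
move=> F0 tL Ucov FV; set Y := covered L; set Y' := covered (pass L Us F) => leb.
have tY : tame a Y.
  by apply: tame_covered_entry => p pL; apply: tL; rewrite mem_cat pL orbT.
have [bY _] := tY; have [bY' _] : tame a Y' by exact: tame_covered_entry.
have bHY : borel (tower_support a Y FV) by exact: tower_support_borel.
pose E := ~` tower_support a Y FV; have bE : borel E by exact: borelC.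
have bs s : borel (a s @^-1` Y') by exact: borel_preimage.
have F_gt0 : 0 < #|` F|%:R :> R by rewrite ltr0n cardfs_gt0.
have count : eps * #|` F|%:R * m E <= \sum_(s <- F) m (E `&` a s @^-1` Y').
  apply: (invm_count_ge mu_inv) => //; first by rewrite mulr_ge0// ltW.
  by move=> x _; rewrite sum_visits; exact: pass_visits.
have bD : borel (Y' `\` Y) by exact: borelD.
have each s : s \in (F : seq _) -> m (E `&` a s @^-1` Y') <= m (Y' `\` Y).
  move=> sF; rewrite -[leRHS](invm_preimage mu_inv s bD).
  apply: (invm_le mu_inv); [exact: borelI|exact: borel_preimage|].
  move=> x [Ex Yx]; split => // Ysx; apply: Ex; exists s^-1%g.
    by apply/imfsetP; exists s.
  by exists (a s x) => //; rewrite actK.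
have sum_le : \sum_(s <- F) m (E `&` a s @^-1` Y') <= #|` F|%:R * m (Y' `\` Y).
  apply: (@le_trans _ _ (\sum_(s <- F) m (Y' `\` Y))).
    by rewrite !big_seq; apply: ler_sum => s; exact: each.
  by rewrite big_const_seq count_predT iter_addr_0 mulr_natl.
have gain : eps * m E <= m (Y' `\` Y).
  by rewrite -(ler_pM2l F_gt0); apply: le_trans sum_le; rewrite mulrCA mulrA.
have YY' : Y `<=` Y' by exact: covered_pass_sub.
have mY' : m Y' = m Y + m (Y' `\` Y).
  by rewrite (invm_split mu_inv bY' bY) (setIidr YY').
have mE : 1 - m Y - beta <= m E.
  rewrite (invmC mu_inv bHY) (invm_split mu_inv bHY bY).
  have : m (tower_support a Y FV `&` Y) <= m Y.
    by apply: (invm_le mu_inv) => //; exact: borelI.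
  by move: leb; lra.
have := ler_wpM2l (ltW eps_gt0) mE; rewrite mY'; move: gain.
by rewrite !(mulrBr, mulrBl, mulrDr, mul1r, mulr1); lra.
Qed.

Definition tiling (Us : {fset G} -> seq (set X)) (Fs : seq {fset G}) :=
  foldr (fun F L => pass L (Us F) F) [::] Fs.

Lemma mem_tiling Us Fs p : p \in tiling Us Fs ->
  p.2 \in Fs /\ p.1 \in Us p.2.
Proof.
elim: Fs => //= F Fs IH; rewrite mem_cat inE => /orP[/mapP[U UU ->]|/IH[-> ->]].
  by rewrite eqxx.
by rewrite orbT.
Qed.

(** Every pass covers a definite proportion of what was left, up to an error
    controlled by the invariance of the larger tiles under the smaller ones;
    hence the tiles of a shape are laid before those of the shapes in front of
    it in the list, under whose inverses it is almost invariant. *)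
Lemma tiling_mass (eta : R) Us Fs : 0 <= eta ->
  (forall F, F \in Fs -> [/\ F != fset0,
     forall U, U \in Us F -> tame a U /\ is_tower a U F &
     forall x, exists2 U, U \in Us F & U x]) ->
  pairwise (fun F F' => let FV := [fset g^-1%g | g in F]%fset in
     #|` mulfs FV F' `\` F'|%fset%:R <= eta * #|` F'|%:R) Fs ->
  1 - m (covered (tiling Us Fs)) <= (1 - eps) ^+ size Fs + eta / (1 - eps).
Proof.
move=> eta0; have e1 : 0 < 1 - eps by rewrite subr_gt0.
elim: Fs => [_ _|F Fs IH FsP] /=.
  by rewrite (invm0 mu_inv) subr0 expr0 lerDl divr_ge0// ltW.
move=> /andP[/allP Fall pw]; have [F0 FU Fcov] := FsP F (mem_head _ _).
have {}IH := IH (fun F' F'Fs => FsP F' (mem_behead (s := F :: Fs) F'Fs)) pw.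
have tT p : p \in tiling Us Fs -> tame_entry p.
  move=> /mem_tiling[pF pU].
  by have [_ /(_ _ pU) + _] := FsP p.2 (mem_behead (s := F :: Fs) pF).
have tP p : p \in pass (tiling Us Fs) (Us F) F -> tame_entry p.
  by rewrite mem_cat => /orP[/mapP[U /FU UU ->]|/tT].
have inv : (1 - eps) * m (tower_support a (covered (tiling Us Fs))
    [fset g^-1%g | g in F]%fset `\` covered (tiling Us Fs)) <= eta.
  apply: le_trans (covered_invariant eta0 tT _) _.
    by move=> p /mem_tiling[pF _]; exact: Fall.
  rewrite ler_piMr//; apply: (invm_le1 mu_inv).
  by have [] := tame_covered_entry tT.
rewrite mulrC -ler_pdivlMr// in inv.
apply: le_trans (pass_mass F0 tP Fcov inv) _.
have := ler_wpM2l (ltW e1) IH; rewrite exprS.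
by move: (_ / _) (m _) (_ ^+ _) => b y z; lra.
Qed.

End TilingMass.

(** * The equivalence *)

Lemma fsubset_card (T : choiceType) (S : {fset T}) k : (k <= #|` S|)%N ->
  exists2 P : {fset T}, (P `<=` S)%fset & #|` P| = k.
Proof.
move=> kS; exists [fset x in take k (enum_fset S)]%fset.
  by apply/fsubsetP => x; rewrite !inE => /mem_take.
rewrite card_fseq undup_id; first by rewrite size_take_min; apply/minn_idPl.
exact/take_uniq/fset_uniq.
Qed.

Section Shapes.
Context {R : realType} {G : groupType}.
Implicit Types K F S : {fset G}.
Hypothesis G_amenable : amenable R G.

Lemma card_mulfs_ge K F : F != fset0 -> (#|` K| <= #|` mulfs K F|)%N.
Proof.
move=> /fset0Pn[f fF].
have <- : #|` [fset (k * f)%g | k in K]%fset| = #|` K|.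
  by rewrite card_imfset//; exact: mulIg.
apply: fsubset_leq_card; apply/fsubsetP => _ /imfsetP[/= k kK ->].
by apply/mulfsP; exists k => //; exists f.
Qed.

Lemma mulfsS K K' F : (K `<=` K')%fset -> (mulfs K F `<=` mulfs K' F)%fset.
Proof.
move=> KK'; apply/fsubsetP => _ /mulfsP[k kK [f fF ->]].
by apply/mulfsP; exists k; [exact: (fsubsetP KK')|exists f].
Qed.

Lemma mulfs1_le K F (e : R) g : #|` mulfs K F `\` F|%fset%:R < e * #|` F|%:R ->
  g \in K -> #|` mulfs [fset g]%fset F `\` F|%fset%:R <= e * #|` F|%:R.
Proof.
move=> KF gK; apply: le_trans _ (ltW KF); rewrite ler_nat.
by apply/fsubset_leq_card/fsetSD; apply: mulfsS; rewrite fsub1set.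
Qed.

(** Translates of [S] leave [S] only into [F `\` S] or by leaving [F]; both
    defects are at most [eps * #|F|], and the opposite defect is no larger. *)
Lemma ample_invariant (eps : R) K F S : 0 < eps -> eps < 2^-1 -> K != fset0 ->
  #|` mulfs K F `\` F|%fset%:R <= eps * #|` F|%:R ->
  (S `<=` F)%fset -> ample eps F S -> S != fset0 ->
  invariant_shape K (16 * eps) S.
Proof.
move=> e0 e2 /fset0Pn[k kK] KF SF aS S0; rewrite /invariant_shape -/(mulfs K S).
have dS : #|` F `\` S|%fset%:R <= eps * #|` F|%:R :> R.
  rewrite cardfsDS// natrB ?fsubset_leq_card//; move: aS; rewrite /ample; lra.
have KS : #|` mulfs K S `\` S|%fset%:R <= 2 * eps * #|` F|%:R :> R.
  apply: (@le_trans _ _ (#|` (mulfs K F `\` F) `|` (F `\` S)|%fset%:R)).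
    rewrite ler_nat; apply: fsubset_leq_card; apply/fsubsetP => x.
    rewrite !inE => /andP[xS xKS].
    have xKF : x \in mulfs K F.
      case/mulfsP: xKS => l lK [s sS ->]; apply/mulfsP; exists l => //; exists s => //.
      exact: (fsubsetP SF).
    by rewrite xKF xS; case: (x \in F).
  apply: (@le_trans _ _ (#|` mulfs K F `\` F|%fset%:R + #|` F `\` S|%fset%:R)).
    by rewrite -natrD ler_nat -cardfsUI leq_addr.
  lra.
have SK : (#|` S `\` mulfs K S|%fset <= #|` mulfs K S `\` S|%fset)%N.
  have le : (#|` S| <= #|` mulfs K S|)%N.
    have <- : #|` [fset (k * s)%g | s in S]%fset| = #|` S|.
      by rewrite card_imfset//; exact: mulgI.
    apply: fsubset_leq_card; apply/fsubsetP => _ /imfsetP[/= s sS ->].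
    by apply/mulfsP; exists k => //; exists s.
  move: le; rewrite -(cardfsID (mulfs K S) S) -(cardfsID S (mulfs K S)).
  by rewrite fsetIC leq_add2l.
apply: (@le_lt_trans _ _ (4 * eps * #|` F|%:R)).
  apply: (@le_trans _ _ (#|` mulfs K S `\` S|%fset%:R + #|` S `\` mulfs K S|%fset%:R)).
    by rewrite -natrD ler_nat -cardfsUI leq_addr.
  by move: SK; rewrite -(ler_nat R); move: KS; lra.
have S_gt0 : 0 < #|` S|%:R :> R by rewrite ltr0n cardfs_gt0.
have F_ge0 : 0 <= #|` F|%:R :> R by [].
have F2S : #|` F|%:R <= 2 * #|` S|%:R :> R.
  have : 0 <= (2^-1 - eps) * #|` F|%:R by rewrite mulr_ge0// subr_ge0 ltW.
  by move: aS; rewrite /ample; lra.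
have := ler_wpM2l (ltW e0) F2S; have := mulr_gt0 e0 S_gt0.
by lra.
Qed.

(** The head of the list, the smallest shape, is chosen first; the others are
    then chosen almost invariant under its inverse. *)
Lemma folner_chain (d eta : R) K n : 0 < d -> 0 < eta ->
  exists Fs : seq {fset G}, [/\ size Fs = n,
    forall F, F \in Fs -> F != fset0 /\
      #|` mulfs K F `\` F|%fset%:R <= d * #|` F|%:R
  & pairwise (fun F F' => let FV := [fset g^-1%g | g in F]%fset in
     #|` mulfs FV F' `\` F'|%fset%:R <= eta * #|` F'|%:R) Fs].
Proof.
move=> d0 eta0; elim: n d d0 K => [|n IH] d d0 K; first by exists [::].
have [F F0 KF] := amenable_folner G_amenable K d0.
pose FV := [fset g^-1%g | g in F]%fset.
have de : 0 < Num.min d eta by rewrite lt_min d0.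
have [Fs [sFs FsP pw]] := IH _ de (K `|` FV)%fset.
have mono H F' (e : R) : (H `<=` K `|` FV)%fset -> Num.min d eta <= e ->
    F' \in Fs -> #|` mulfs H F' `\` F'|%fset%:R <= e * #|` F'|%:R.
  move=> HK ee F'Fs; have [_ H'] := FsP F' F'Fs.
  apply: (@le_trans _ _ (Num.min d eta * #|` F'|%:R)); last exact: ler_wpM2r.
  apply: le_trans H'; rewrite ler_nat; apply/fsubset_leq_card/fsetSD.
  exact: mulfsS.
exists (F :: Fs); split; first by rewrite /= sFs.
- move=> F'; rewrite inE => /orP[/eqP->|F'Fs]; first by split => //; exact: ltW.
  split; first by have [] := FsP F' F'Fs.
  by apply: mono => //; [exact: fsubsetUl|rewrite ge_min lexx].
- rewrite pairwise_cons pw andbT; apply/allP => F' F'Fs /=.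
  by apply: mono => //; [exact: fsubsetUr|rewrite ge_min lexx orbT].
Qed.

End Shapes.

Section Main.
Context {R : realType} {G : groupType} {X : metricType R}.
Variable a : continuous_action G X.
Implicit Types (g h : G) (A B C U V : set X) (F K S : {fset G}).
Hypothesis G_infinite : infinite_set [set: G].
Hypothesis G_amenable : amenable R G.
Hypothesis X_compact : compact [set: X].
Hypothesis a_free : free_action a.

Lemma thicken_open (k : R) A : open (thicken k A).
Proof.
rewrite openE => x [y Ay yx].
have e0 : 0 < k - mdist y x by rewrite subr_gt0.
apply: filterS (nbhsx_ballx x _ e0) => z; rewrite ballEmdist/= => xz.
by exists y => //; apply: le_lt_trans (metric_triangle y x z) _; lra.
Qed.

(** Without invariant measures [uniform_gap] would hold vacuously for [X] and
    the empty set. *)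
Lemma invariant_measure_exists : [set: X] !=set0 ->
  exists mu : set X -> \bar R, invariant_measures a mu.
Proof.
move=> [x _]; apply: contrapT => nomu.
have [] := @uniform_gap R G X a X_compact setT set0 0 closedT open0.
  by move=> mu mu_inv; exfalso; apply: nomu; exists mu.
move=> e [K [e0 gap]]; have [F F0 KF] := amenable_folner G_amenable K e0.
have := gap F F0 (fun g => mulfs1_le KF) x; rewrite addr0.
have -> : thicken e setT = setT :> set X.
  by apply/seteqP; split => // y _; exact: sub_thicken.
rewrite empT// => H; have : 1 + e <= 1.
  exact: le_trans H (emp_le1 _ _ _ _).
by rewrite gerDl leNgt e0.
Qed.

(** The gap between [C] and [X] itself, which persists for a neighbourhood of
    [C] along orbits, and hence in mass. *)
Lemma closed_neighbourhood C (e d : R) : closed C -> 0 < d -> 0 <= e -> e + d <= 1 ->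
  (forall mu : set X -> \bar R, invariant_measures a mu -> fine (mu C) <= e) ->
  exists V, [/\ open V, C `<=` V &
    forall mu : set X -> \bar R, invariant_measures a mu -> fine (mu V) <= e + d].
Proof.
move=> clC d0 e0 ed1 Ce.
have [] := @uniform_gap R G X a X_compact C setT (1 - e - d) clC openT.
  move=> mu mu_inv; rewrite (invm_fin mu_inv (borel_closed clC)).
  rewrite (invm_fin mu_inv (borelT (X := X))) -EFinD lte_fin (invmT mu_inv).
  by have := Ce mu mu_inv; lra.
move=> k [K [k0 gap]]; have [F F0 KF] := amenable_folner G_amenable K k0.
have {}gap := gap F F0 (fun g => mulfs1_le KF).
set O1 := thicken k C in gap.
have oO1 : open O1 by exact: thicken_open.
exists O1; split => //; first exact: sub_thicken.
move=> mu mu_inv; have bO1 := borel_open oO1.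
have F_gt0 : 0 < #|` F|%:R :> R by rewrite ltr0n cardfs_gt0.
have : (1 - e - d) * #|` F|%:R * fine (mu setT) <=
    \sum_(s <- F) fine (mu (setT `&` a s @^-1` (~` O1))).
  apply: (invm_count_ge mu_inv) => //.
  - by rewrite mulr_ge0//; lra.
  - exact: borelT.
  - by move=> s; apply: borel_preimage; exact: borelC.
  - move=> x _; rewrite (sum_visits a F x (~` O1)).
    have := gap x; rewrite /emp; have := emp_le1 a F x (~` thicken k (~` setT)).
    rewrite /emp => le1 /le_trans/(_ le1).
    rewrite -(ler_pM2r F_gt0) mulrDl mulrDl divfK ?gt_eqF// mul1r.
    rewrite -(card_visitsC a F x O1) natrD => H.
    have := mulr_gt0 k0 F_gt0; rewrite -(card_visitsC a F x O1) natrD; lra.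
under eq_bigr => s _ do rewrite setTI (invm_preimage mu_inv s (borelC bO1)).
rewrite (invmT mu_inv) (invmC mu_inv bO1) mulr1 big_const_seq count_predT.
by rewrite iter_addr_0 -[X in _ <= X]mulr_natr ler_pM2r//; lra.
Qed.

(** Freeness separates the points [s x], [s] in [F], so that small enough
    neighbourhoods of [x] are bases of towers of shape [F]. *)
Lemma small_towers_cover F (d : R) : small_boundary_property R a -> 0 < d ->
  exists Us : seq (set X), (forall U, U \in Us -> [/\ open U, tame a U,
      is_tower a U F & forall s, s \in F -> (diameter (a s @` U) < d%:E)%E]) /\
    forall x, exists2 U, U \in Us & U x.
Proof.
move=> [B [Bo Bb] B0] d0.
have /choice[f fP] (x : X) : exists U, [/\ B U, U x, is_tower a U F &
    forall s, s \in F -> (diameter (a s @` U) < d%:E)%E].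
  pose r s t : R := if s == t then d / 3 else mdist (a s x) (a t x) / 2.
  have r0 s t : 0 < r s t.
    rewrite /r; case: eqVneq => [_|st]; first by rewrite divr_gt0.
    rewrite divr_gt0// mdist_gt0; apply/eqP => sxtx.
    have : a (t^-1 * s)%g x = x by rewrite actM sxtx actK.
    by move=> /a_free /mulg1_eq; rewrite invgK => ts; rewrite ts eqxx in st.
  pose N s t : set X := [set y | mdist (a s x) (a s y) < r s t].
  have nN s t : nbhs x (N s t).
    have := @act_continuous _ _ a s x _ (nbhsx_ballx (a s x) _ (r0 s t)).
    by rewrite ballEmdist.
  have nNN : nbhs x (\bigcap_(s in [set` F]) \bigcap_(t in [set` F]) N s t).
    by apply: filter_bigI => s _; apply: filter_bigI => t _; exact: nN.
  have [U [BU Ux] UN] := Bb x _ nNN.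
  have near s t y : s \in F -> t \in F -> U y -> mdist (a s x) (a s y) < r s t.
    by move=> sF tF /UN/(_ s sF t tF).
  exists U; split => // [s t sF tF [_ [[y Uy <-] [z Uz zy]]]|s sF].
    apply/eqP; apply: contraT => st.
    have := near s t y sF tF Uy; have := near t s z tF sF Uz.
    rewrite /r (negbTE st) eq_sym (negbTE st) zy (metric_sym (a t x) (a s x)).
    have := metric_triangle (a s x) (a s y) (a t x).
    by rewrite (metric_sym (a s y) (a t x)); lra.
  apply: (@le_lt_trans _ _ (2 * d / 3)%:E); last by rewrite lte_fin; lra.
  apply: ge_ereal_sup => _ [_ [y Uy <-] [_ [z Uz <-] <-]]; rewrite lee_fin.
  have := near s s y sF sF Uy; have := near s s z sF sF Uz; rewrite /r eqxx.
  have := metric_triangle (a s y) (a s x) (a s z).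
  by rewrite (metric_sym (a s y) (a s x)); lra.
have oF x : open (f x) by have [/Bo] := fP x.
have [x _|D XD] := compact_finite_cover X_compact oF.
  by exists x => //; have [] := fP x.
exists [seq f x | x <- D]; split => [_ /mapP[x _ ->]|x].
  have [Bf _ tf df] := fP x; split => //.
  split => [|mu mu_inv]; first exact: borel_open.
  by rewrite (B0 _ Bf mu mu_inv).
have [y /= yD fy] := XD x I; exists (f y) => //; exact: map_f.
Qed.

Lemma pow_small (q e : R) : 0 < q -> q < 1 -> 0 < e -> exists n, q ^+ n <= e.
Proof.
move=> q0 q1 e0.
have : (fun n => q ^+ n) @ \oo --> 0 by apply: cvg_expr; rewrite gtr0_norm.
move=> /cvgrPdist_le/(_ e e0)[n _ /(_ n (leqnn n))] /=.
by rewrite sub0r normrN gtr0_norm ?exprn_gt0// => H; exists n.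
Qed.

(** Almost finiteness up to a remainder of small mass.  The castle is cut from a
    quasi-tiling; its bases have null boundaries by the small boundary property,
    so that passing to interiors costs no mass. *)
Lemma almost_finite_in_measure K (d e : R) (N : nat) :
  small_boundary_property R a -> K != fset0 -> 0 < d -> 0 < e ->
  exists (I : finType) (V : I -> set X) (S : I -> {fset G}),
    [/\ is_open_castle a V S, forall i, invariant_shape K d (S i),
        forall i s, s \in S i -> (diameter (a s @` V i) < d%:E)%E,
        forall i, (N <= #|` S i|)%N
      & forall mu : set X -> \bar R, invariant_measures a mu ->
          1 - fine (mu (\bigcup_i tower_support a (V i) (S i))) <= e].
Proof.
move=> sbp K0 d0 e0.
(* The constant is such that [eps < 1 / 2] and [16 * eps <= d], as needed by
   [ample_invariant]. *)
pose eps := d / (16 + 2 * d).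
have den : 0 < 16 + 2 * d by lra.
have eps0 : 0 < eps by exact: divr_gt0.
have eps2 : eps < 2^-1 by rewrite /eps ltr_pdivrMr//; lra.
have eps16 : 16 * eps <= d by rewrite /eps mulrA ler_pdivrMr//; nra.
have eps1 : eps < 1 by lra.
have e1 : 0 < 1 - eps by lra.
pose eta := (e / 2) * (1 - eps).
have eta0 : 0 < eta by rewrite mulr_gt0// divr_gt0.
(* Almost invariance under the large set [B] forces the shapes to be large. *)
have [B _ cardB] := infinite_set_fset (4 * N)%N G_infinite.
have [p pe] := @pow_small (1 - eps) (e / 2) e1 ltac:(lra) ltac:(lra).
have [Fs [sFs FsP pw]] := folner_chain G_amenable (K `|` B)%fset p eps0 eta0.
have /choice[Us UsP] F := @small_towers_cover F d sbp d0.
pose Q S := invariant_shape K d S /\ (N <= #|` S|)%N.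
have goodQ F S : F \in Fs -> (S `<=` F)%fset -> ample eps F S -> Q S.
  move=> /FsP[F0 FK] SF aS.
  have F_gt0 : 0 < #|` F|%:R :> R by rewrite ltr0n cardfs_gt0.
  have KF : #|` mulfs K F `\` F|%fset%:R <= eps * #|` F|%:R.
    apply: le_trans FK; rewrite ler_nat; apply/fsubset_leq_card/fsetSD.
    by apply: mulfsS; exact: fsubsetUl.
  have S0 : S != fset0.
    apply/eqP => S0; move: aS; rewrite /ample S0 cardfs0 leNgt => /negP[].
    exact: mulr_gt0.
  split.
    have := ample_invariant eps0 eps2 K0 KF SF aS S0; rewrite /invariant_shape.
    by move=> /lt_le_trans; apply; rewrite ler_wpM2r.
  have : (4 * N <= #|` F| + #|` mulfs (K `|` B) F `\` F|%fset)%N.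
    apply: leq_trans cardB _; apply: leq_trans (card_mulfs_ge B F0) _.
    apply: leq_trans (fsubset_leq_card (_ : _ `<=` F `|` (mulfs (K `|` B) F `\` F))%fset) _.
      apply/fsubsetP => x xBF; have : x \in mulfs (K `|` B)%fset F.
        by apply: (fsubsetP (mulfsS _ _)) xBF; exact: fsubsetUr.
      by rewrite !inE => ->; case: (x \in F).
    by rewrite -cardfsUI leq_addr.
  rewrite -(ler_nat R) natrD natrM -(ler_nat R); move: aS FK; rewrite /ample.
  by set x := #|` F|%:R; set y := #|` S|%:R; set z := #|` _|%:R; nra.
have Ltame q : q \in tiling Us Fs -> tame_towers a eps d Q q.
  move=> /mem_tiling[qF qU]; have [/(_ _ qU)[_ tq towq dq] _] := UsP q.2.
  by split => // S; exact: goodQ.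
have [I [V0 [S [castle0 supp tV0 QS dV0]]]] := covered_castle Ltame.
pose V i := (V0 i)°.
have VV0 i : V i `<=` V0 i by exact: interior_subset.
have oV i : open (V i) by exact: open_interior.
have levelS i s : a s @` V i `<=` a s @` V0 i by apply: image_subset; exact: VV0.
have suppS i : tower_support a (V i) (S i) `<=` tower_support a (V0 i) (S i).
  by move=> x [s ss /levelS sx]; exists s.
have castle : is_castle a V S.
  split=> [i s t ss tt [x [/levelS xs /levelS xt]]|i j _ _ [x [/suppS xi /suppS xj]]].
    by apply: (castle0.1 i) => //; exists x.
  by apply: castle0.2 => //; exists x.
exists I, V, S; split => //.
- by move=> i; have [] := QS i.
- move=> i s /dV0; apply: le_lt_trans; exact: diameterS (levelS i s).
- by move=> i; have [] := QS i.
move=> mu mu_inv.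
have bV i : borel (V i) by exact: borel_open.
have bV0 i : borel (V0 i) by case: (tV0 i).
have -> : fine (mu (\bigcup_i tower_support a (V i) (S i))) =
    fine (mu (covered a eps (tiling Us Fs))).
  rewrite -supp (castle_mass mu_inv castle bV) (castle_mass mu_inv castle0 bV0).
  apply: eq_bigr => i _; congr (_ * _).
  rewrite [RHS](invm_split mu_inv (bV0 i) (bV i)) (setIidr (VV0 i)).
  rewrite (_ : fine (mu (V0 i `\` V i)) = 0) ?addr0//.
  apply: (null_subset mu_inv (borelD (bV0 i) (bV i))
    (borel_closed (@boundary_closed _ _ (V0 i)))); last exact: (tV0 i).2.
  by move=> x [V0x nVx]; split => //; exact: subset_closure.
have H F : F \in Fs -> [/\ F != fset0,
     forall U, U \in Us F -> tame a U /\ is_tower a U F &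
     forall x, exists2 U, U \in Us F & U x].
  move=> /FsP[F0 _]; have [UF Fcov] := UsP F; split => // U /UF[]; by split.
apply: le_trans (tiling_mass eps0 eps1 mu_inv (ltW eta0) H pw) _.
by rewrite sFs /eta mulfK ?gt_eqF//; move: pe; lra.
Qed.

(** In each tower take [q] levels [S0] and, for the final target, [(m + 1) * q]
    levels [S'], less than one [n]-th of all levels.  Together the levels in [S0]
    have more mass than a neighbourhood of the remainder; the subequivalence given
    by [m]-comparison leads there, and an injection of the pairs of a colour and
    a level of [S0] into [S'] moves the colours apart. *)
Lemma comparison_almost_finite (m : nat) : small_boundary_property R a ->
  has_comparison R a m -> almost_finite a.
Proof.
move=> sbp comp n K d n1 K0 d0.
(* As [q] is the quotient of the number of levels by [N], the [m.+1 * q] levels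
   of [S'] are strictly less than one [n]-th. *)
pose N := (n * m.+1).+1.
have N_gt0 : 0 < N%:R :> R by rewrite ltr0n.
(* A tower has at least [N] levels, so [q] is more than [1 / (2 * N)] of them,
   and the mass of [S0], at least [(1 - e) / (2 * N)], exceeds [2 * e]. *)
pose e : R := (10 * N%:R)^-1.
have e0 : 0 < e by rewrite invr_gt0 mulr_gt0.
have eN : e * N%:R = 10^-1 by rewrite /e invfM mulrVK ?unitfE ?gt_eqF.
have e1 : e + e <= 1.
  have : 1 <= N%:R :> R by rewrite ler1n.
  by move: eN e0; nra.
have [I [V [S [[castle oV] Sinv diam SN mass]]]] :=
  @almost_finite_in_measure K d e N sbp K0 d0 e0.
have bV i : borel (V i) by exact: borel_open.
pose q i := (#|` S i| %/ N)%N.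
have /choice[S0 S0P] i : exists S0 : {fset G},
    (S0 `<=` S i)%fset /\ #|` S0| = q i.
  have [P PS Pq] := @fsubset_card _ (S i) (q i) (leq_div _ _).
  by exists P.
have qN i : (n * (m.+1 * q i) < #|` S i|)%N.
  have := leq_divM #|` S i| N; rewrite -/(q i).
  have : (0 < #|` S i|)%N by exact: leq_trans (SN i).
  rewrite mulnA /N; move: (n * m.+1)%N (q i) #|` S i| => k r l; nia.
have /choice[S' S'P] i : exists S' : {fset G},
    (S' `<=` S i)%fset /\ #|` S'| = (m.+1 * q i)%N.
  have [|P PS Pq] := @fsubset_card _ (S i) (m.+1 * q i); last by exists P.
  by apply: leq_trans (ltnW (qN i)); rewrite leq_pmull.
exists I, V, S, S'; split => //.
  move=> i; split; first exact: (S'P i).1.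
  by rewrite (S'P i).2 ltr_pdivlMr ?ltr0n// -natrM ltr_nat mulnC.
set Rm := ~` _.
have clR : closed Rm by exact: castle_remainder_closed oV.
have Re (mu : set X -> \bar R) : invariant_measures a mu -> fine (mu Rm) <= e.
  move=> mu_inv; rewrite (invmC mu_inv (castle_support_borel a S bV)).
  exact: mass.
have [Rm0|Rm0] := pselect (Rm !=set0); last first.
  apply: (@family_subequivalent _ _ _ _ nat set0 (fun=> set0) (fun=> 1%g)) => //.
  by move=> x Rx; exfalso; apply: Rm0; exists x.
have [W [oW RW We]] := closed_neighbourhood clR e0 (ltW e0) e1 Re.
pose B0 := \bigcup_i tower_support a (V i) (S0 i).
have castleS0 : is_castle a V S0 by apply: sub_castle castle (fun i => (S0P i).1).
have B0E : B0 = \bigcup_(p in in_castle S0) level a V p by exact: castle_supportE.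
have oB0 : open B0 by rewrite B0E; apply: bigcup_open => p _; exact: act_open.
have bB0 : borel B0 by exact: borel_open.
have ltWB (mu : set X -> \bar R) : invariant_measures a mu ->
    fine (mu W) < fine (mu B0).
  move=> mu_inv; rewrite (castle_mass mu_inv castleS0 bV).
  have := mass mu mu_inv; rewrite (castle_mass mu_inv castle bV) => mass1.
  have le : (\sum_i #|` S i|%:R * fine (mu (V i))) * (2 * N%:R)^-1 <=
      \sum_i #|` S0 i|%:R * fine (mu (V i)).
    rewrite mulr_suml; apply: ler_sum => i _; rewrite mulrAC.
    apply: ler_wpM2r; first exact: (invm_ge0 mu_inv).
    rewrite (S0P i).2 ler_pdivrMr ?mulr_gt0// -!natrM ler_nat.
    have q1 : (0 < q i)%N by rewrite divn_gt0// SN.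
    have := ltn_ceil #|` S i| (ltn0Sn (n * m.+1)); rewrite -/N -/(q i) => lt.
    apply: leq_trans (ltnW lt) _; rewrite mulnA [(q i * 2)%N]mulnC mul2n -addnn.
    by rewrite -addn1 leq_mul2r leq_add2l q1 orbT.
  have lt : (1 - e) * (2 * N%:R)^-1 <=
      (\sum_i #|` S i|%:R * fine (mu (V i))) * (2 * N%:R)^-1.
    by apply: ler_wpM2r; [rewrite invr_ge0 mulr_ge0|lra].
  apply: le_lt_trans (We mu mu_inv) _; apply: (lt_le_trans _ (le_trans lt le)).
  rewrite ltr_pdivlMr ?mulr_gt0//.
  have -> : (e + e) * (2 * N%:R) = 4 * (e * N%:R) by ring.
  by rewrite eN; lra.
have [x0 Rx0] := Rm0.
have B00 : B0 !=set0.
  have [mu mu_inv] : exists mu : set X -> \bar R, invariant_measures a mu.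
    by apply: invariant_measure_exists; exists x0.
  apply: contrapT => /nonemptyPn B00; have := ltWB mu mu_inv.
  by rewrite B00 (invm0 mu_inv) ltNge (invm_ge0 mu_inv).
have W0 : W !=set0 by exists x0; exact: RW.
have [|UU [s [c [finUU oUU RUU trUU]]]] := comp W B0 oW oB0 W0 B00 _ Rm clR RW.
  move=> mu mu_inv; have bW := borel_open oW.
  by rewrite (invm_fin mu_inv bW) (invm_fin mu_inv bB0) lte_fin; exact: ltWB.
pose Ei i := [fset p in [seq (k, g) | k <- enum 'I_m.+1, g <- enum_fset (S0 i)]]%fset.
have inEi i k g : ((k, g) \in Ei i) = (g \in S0 i).
  rewrite inE; apply/allpairsP/idP => [[[k' g'] [_ gS [_ ->]]]//|gS].
  by exists (k, g); split => //; rewrite mem_enum.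
have /choice[f fP] i : exists f : 'I_m.+1 * G -> G,
    {in Ei i &, injective f} /\ {in Ei i, forall p, f p \in S' i}.
  apply: (fset_injection 1%g); rewrite card_fseq (S'P i).2.
  apply: leq_trans (size_undup _) _.
  by rewrite size_allpairs size_enum_ord (S0P i).2.
pose Ec (k : 'I_m.+1) := in_castle S0.
apply: (@rearrange _ _ _ a _ _ _ UU id s c (in_castle S) (level a V) Ec
  (fun k p => (p.1, f p.1 (k, p.2))) (fun k p => (f p.1 (k, p.2) * p.2^-1)%g)) => //.
- exact: finite_in_castle.
- exact: level_trivIset.
- by move=> p _; exact: act_open.
- by move=> U U' UU1 UU2 cU; apply: (trUU (c U)).1; split => //=.
- by move=> U UU1; rewrite -B0E; apply: (trUU (c U)).2.
- move=> k p pS0; have Ep : (k, p.2) \in Ei p.1 by rewrite inEi.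
  have fS' := (fP p.1).2 _ Ep; split.
  + exact: (fsubsetP (S0P p.1).1).
  + exact: (fsubsetP (S'P p.1).1).
  + by rewrite /level/= -act_imageM mulgVK.
  + by move=> x px; exists p.1 => //; exists (f p.1 (k, p.2)).
- move=> k p k' p' pS pS' [p1]; rewrite -p1.
  have Ep : (k, p.2) \in Ei p.1 by rewrite inEi.
  have Ep' : (k', p'.2) \in Ei p.1 by rewrite p1 inEi.
  move=> /((fP p.1).1 _ _ Ep Ep')[-> p2]; split => //.
  by case: p p' p1 p2 {pS pS' Ep Ep'} => i g [i' g'] /= -> ->.
Qed.

End Main.

Theorem theoremA (R : realType) (G : groupType) (X : metricType R)
    (a : continuous_action G X)
    (G_countable : countable [set: G]) (G_infinite : infinite_set [set: G])
    (G_amenable : amenable R G)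
    (X_compact : compact [set: X])
    (a_free : free_action a) :
  (almost_finite a <->
     small_boundary_property R a /\ has_comparison R a 0) /\
  (almost_finite a <->
     small_boundary_property R a /\ exists m : nat, has_comparison R a m).
Proof.
have sbp := almost_finite_small_boundary X_compact (a := a).
have comp := almost_finite_comparison X_compact (a := a).
have af := comparison_almost_finite G_infinite G_amenable X_compact a_free.
split; split => [H|].
- by split; [exact: sbp|exact: comp].
- by move=> [s /(af _ s)].
- by split; [exact: sbp|exists 0%N; exact: comp].
- by move=> [s [m /(af _ s)]].
Qed.
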